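(* (A) Let $(s(m,n))_{m,n=0}^{\infty}$ be a bisequence of complex numbers satisfying $$s(m+3,n)-3s(m+2,n+1)+3s(m+1,n+2)-s(m,n+3)=0,\qquad m,n\in\mathbb{N}.$$ Then there exists a form $\boldsymbol{s}$ over $\mathbb{N}\times\mathbb{N}\times\mathbb{C}^2\times\mathbb{C}^2$ which is translation invariant, i.e. $$\boldsymbol{s}(m+k,n,\boldsymbol{a},\boldsymbol{b})=\boldsymbol{s}(m,n+k,\boldsymbol{a},\boldsymbol{b}),\qquad m,n,k\in\mathbb{N},\ \boldsymbol a,\boldsymbol b\in\mathbb{C}^2,$$ and which is related to $s$ by $$s(m,n)=\boldsymbol{s}(m,n,\boldsymbol{e}_0,\boldsymbol{e}_0)+m\,\boldsymbol{s}(m-1,n,\boldsymbol{e}_1,\boldsymbol{e}_0)+n\,\boldsymbol{s}(m,n-1,\boldsymbol{e}_0,\boldsymbol{e}_1)+mn\,\boldsymbol{s}(m-1,n-1,\boldsymbol{e}_1,\boldsymbol{e}_1),\qquad m,n\in\mathbb{N}. \quad( * )$$ Furthermore, if such a form $\boldsymbol{s}$ (translation invariant and satisfying $( * )$) is additionally positive definite, then $s$ is a Sobolev moment bisequence. (B) Conversely, let $(s(m,n))_{m,n=0}^\infty$ be a Sobolev moment bisequence with representing matrix of measures $(\mu_{i,j})_{i,j=0}^1$. Then $$s(m+3,n)-3s(m+2,n+1)+3s(m+1,n+2)-s(m,n+3)=0,\qquad m,n\in\mathbb{N},$$ and the form $$\boldsymbol{s}(m,n,\boldsymbol{a},\boldsymbol{b})=\sum_{i,j=0}^{1}a_i\overline{b_j}\int_{\mathbb{R}}t^{m+n}\,d\mu_{i,j}(t),\qquad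 \boldsymbol{a}=(a_0,a_1),\ \boldsymbol{b}=(b_0,b_1)\in\mathbb{C}^2,$$ satisfies $( * )$, is translation invariant and is positive definite.
   Context: $\mathbb{N}=\{0,1,2,\dots\}$; $\boldsymbol{e}_0=(1,0)$ and $\boldsymbol{e}_1=(0,1)$ in $\mathbb{C}^2$. Convention: whenever a negative integer argument appears, the corresponding entry is $0$. A form over $\mathbb{N}\times\mathbb{N}\times\mathbb{C}^2\times\mathbb{C}^2$ is a function $\boldsymbol{t}:\mathbb{N}\times\mathbb{N}\times\mathbb{C}^2\times\mathbb{C}^2\to\mathbb{C}$ such that for all $m,n\in\mathbb{N}$ the map $\boldsymbol{t}(m,n,\cdot,-)$ is sesquilinear (linear in the first vector variable, antilinear in the second). It is positive definite if $\sum_{k,l}\boldsymbol{t}(m_k,m_l,\boldsymbol{a}_k,\boldsymbol{a}_l)\ge 0$ for all finite sequences $(m_k)_k$ in $\mathbb{N}$ and $(\boldsymbol{a}_k)_k$ in $\mathbb{C}^2$ (of the same length). A bisequence $s$ is a Sobolev moment bisequence if there is a $2\times2$ positive definite matrix $(\mu_{i,j})_{i,j=0}^1$ of (in general complex) Borel measures on $\mathbb{R}$, for which all the integrals below exist, such that $$s(m,n)=\sum_{i,j=0}^{1}\int_{\mathbb{R}}(t^m)^{(i)}(t^n)^{(j)}\,\mu_{i,j}(dt),\qquad m,n\in\mathbb{N},$$ where the superscript $(i)$ denotes the $i$-th derivative in $t$. Positive definiteness of $(\mu_{i,j})$ means that for every Borel set $\rho\subseteq\mathbb{R}$ the complex matrix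 $(\mu_{i,j}(\rho))_{i,j=0}^1$ is positive definite in the sense of nonnegative: $\sum_{i,j=0}^1 c_i\overline{c_j}\,\mu_{i,j}(\rho)\ge0$ for all $c_0,c_1\in\mathbb{C}$. Such $(\mu_{i,j})$ is called a representing matrix of measures for $s$. *)

(* Defs.v *)
From HB Require Import structures.
From mathcomp Require Import all_boot all_order all_algebra.
From mathcomp Require Import all_classical all_reals all_analysis.
From mathcomp Require Export complex.

Set Implicit Arguments.
Unset Strict Implicit.
Unset Printing Implicit Defensive.

Import Order.TTheory GRing.Theory Num.Theory.
Import numFieldNormedType.Exports.

Local Open Scope classical_set_scope.
Local Open Scope ring_scope.
Local Open Scope complex_scope.

Section ChargeIntegral.
Context d (T : measurableType d) (R : realType).
Implicit Types (nu : {charge set T -> \bar R}) (f : T -> R).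

Lemma hahn_pair nu :
  {PN : set T * set T | hahn_decomposition nu PN.1 PN.2}.
Proof.
by apply: cid; have [P [N PN]] := Hahn_decomposition nu; exists (P, N).
Qed.

(* The two parts of the Jordan decomposition; on measurable sets they do not
   depend on the Hahn decomposition that is chosen. *)
Definition charge_pos nu : {finite_measure set T -> \bar R} :=
  jordan_pos (svalP (hahn_pair nu)).
Definition charge_neg nu : {finite_measure set T -> \bar R} :=
  jordan_neg (svalP (hahn_pair nu)).

Definition charge_integrable nu f : Prop :=
  (charge_pos nu).-integrable setT (EFin \o f) /\
  (charge_neg nu).-integrable setT (EFin \o f).

Definition charge_integral nu f : R :=
  Rintegral (charge_pos nu) setT f - Rintegral (charge_neg nu) setT f.

End ChargeIntegral.

Section ComplexMeasure.
Context d (T : measurableType d) (R : realType).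

(* Countable additivity for the topology of R[i], i.e. separately for the real
   and the imaginary parts. *)
Record complex_measure := ComplexMeasure {
  cmeasure :> set T -> R[i] ;
  cmeasure0 : cmeasure set0 = 0 ;
  cmeasure_Re_sigma_additive :
    semi_sigma_additive (fun A => (complex.Re (cmeasure A))%:E) ;
  cmeasure_Im_sigma_additive :
    semi_sigma_additive (fun A => (complex.Im (cmeasure A))%:E) }.

Definition Re_measure (mu : complex_measure) (A : set T) : \bar R :=
  (complex.Re (mu A))%:E.
Definition Im_measure (mu : complex_measure) (A : set T) : \bar R :=
  (complex.Im (mu A))%:E.

Section Parts.
Variable mu : complex_measure.

Let Re0 : Re_measure mu set0 = 0%E.
Proof. by rewrite /Re_measure cmeasure0. Qed.

Let Im0 : Im_measure mu set0 = 0%E.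
Proof. by rewrite /Im_measure cmeasure0. Qed.

HB.instance Definition _ := isCharge.Build _ _ _ (Re_measure mu)
  Re0 (fun _ _ => isT) (@cmeasure_Re_sigma_additive mu).

HB.instance Definition _ := isCharge.Build _ _ _ (Im_measure mu)
  Im0 (fun _ _ => isT) (@cmeasure_Im_sigma_additive mu).

End Parts.

(* For a real integrand this amounts to integrability with respect to the
   total variation of mu. *)
Definition cintegrable (mu : complex_measure) (f : T -> R) : Prop :=
  charge_integrable (Re_measure mu) f /\ charge_integrable (Im_measure mu) f.

Definition cintegral (mu : complex_measure) (f : T -> R) : R[i] :=
  charge_integral (Re_measure mu) f +i* charge_integral (Im_measure mu) f.

End ComplexMeasure.

Section Sobolev.
Context (R : realType).
Local Notation C := R[i].
Implicit Types (s : nat -> nat -> C)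
  (t : nat -> nat -> 'rV[C]_2 -> 'rV[C]_2 -> C)
  (mu : 'I_2 -> 'I_2 -> complex_measure (measurableTypeR R) R).

Definition e0 : 'rV[C]_2 := delta_mx 0 0.
Definition e1 : 'rV[C]_2 := delta_mx 0 1.

Definition third_difference_zero s : Prop := forall m n : nat,
  s (m + 3)%N n - 3 * s (m + 2)%N (n + 1)%N
  + 3 * s (m + 1)%N (n + 2)%N - s m (n + 3)%N = 0.

Definition is_form t : Prop := forall m n : nat,
  (forall b, linear_for *%R (fun a => t m n a b)) /\
  (forall a, linear_for (Num.conj \; *%R) (t m n a)).

Definition translation_invariant t : Prop := forall (m n k : nat) a b,
  t (m + k)%N n a b = t m (n + k)%N a b.

Definition form_posdef t : Prop :=
  forall (N : nat) (m : 'I_N -> nat) (a : 'I_N -> 'rV[C]_2),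
    0 <= \sum_(k < N) \sum_(l < N) t (m k) (m l) (a k) (a l).

(* A term with a negative index is 0: here the truncated predecessor of 0 only
   occurs with a factor 0. *)
Definition form_related s t : Prop := forall m n : nat,
  s m n = t m n e0 e0 + m%:R * t m.-1 n e1 e0 + n%:R * t m n.-1 e0 e1
          + m%:R * n%:R * t m.-1 n.-1 e1 e1.

Definition matrix_measure_posdef mu : Prop :=
  forall rho : set (measurableTypeR R), measurable rho ->
  forall c : 'I_2 -> C,
    0 <= \sum_(i < 2) \sum_(j < 2) c i * (c j)^* * mu i j rho.

(* The product of the i-th derivative of x^m and the j-th derivative of x^n. *)
Definition sobolev_integrand (m n i j : nat) (x : R) : R :=
  derive1n i (fun y : R => y ^+ m) x * derive1n j (fun y : R => y ^+ n) x.

Definition representing_matrix mu s : Prop :=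
  [/\ matrix_measure_posdef mu,
      forall (m n : nat) (i j : 'I_2),
        cintegrable (mu i j) (sobolev_integrand m n i j) &
      forall m n : nat,
        s m n = \sum_(i < 2) \sum_(j < 2)
                  cintegral (mu i j) (sobolev_integrand m n i j)].

Definition sobolev_moment_bisequence s : Prop :=
  exists mu, representing_matrix mu s.

Definition moment_form mu (m n : nat) (a b : 'rV[C]_2) : C :=
  \sum_(i < 2) \sum_(j < 2)
    a 0 i * (b 0 j)^* * cintegral (mu i j) (fun x : R => x ^+ (m + n)).

End Sobolev.

(* Main.v *)
Require Import Defs.
From HB Require Import structures.
From mathcomp Require Import all_boot all_order all_algebra.
From mathcomp Require Import all_classical all_reals all_analysis.
From mathcomp Require Import measurable_realfun.
From mathcomp Require Import ring lra zify.

(** Differentiating monomials turns a Sobolev moment into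
    s(m, n) = S_00(m + n) + m S_10(m + n - 1) + n S_01(m + n - 1)
              + m n S_11(m + n - 2),
    where S_ij(k) is the k-th moment of mu_ij. On the antidiagonal m + n = N this
    is a polynomial of degree at most 2 in m, hence the vanishing third
    difference; conversely a quadratic polynomial in m splits in this way
    (third_difference_form). Positive definiteness of the moment form is seen on
    Riemann sums, cell by cell (moment_form_posdef).

    The remaining statement, that a positive definite translation invariant form
    comes from a matrix of measures, is the Hamburger moment problem for 2 x 2
    matrices (form_representing_matrix). The form is a positive kernel h on
    vector polynomials for which multiplication by x is symmetric. Compressing
    multiplication to polynomials of bounded degree and diagonalising it yields
    finitely many atoms x_r with rank one weights v_r v_r^* whose moments are
    those of the form, up to a small error caused by making h invertible
    (atoms_of_posdef, approx_atoms). An ultralimit of these atomic measures gives,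
    for every vector c, a positive functional L_c on polynomially bounded
    functions, with the prescribed moments, and quadratic in c. Each L_c is
    represented on polynomials by a finite measure m_c, the Lebesgue-Stieltjes
    measure of the right limits of its distribution function
    (functional_measure). The quadratic dependence on c passes to the
    distribution functions and then to all Borel sets (quadratic_form_measure);
    the entries mu_ij are obtained by polarization, and m_c >= 0 says that the
    matrix is positive. *)

Set Implicit Arguments.
Unset Strict Implicit.
Unset Printing Implicit Defensive.

Import Order.TTheory GRing.Theory Num.Theory.
Import numFieldNormedType.Exports.

Local Open Scope classical_set_scope.
Local Open Scope ring_scope.

(** * Integration against the difference of two finite measures *)

Section ChargeIntegralTheory.
Context d (T : measurableType d) (R : realType).
Implicit Types (nu : {charge set T -> \bar R}) (f : T -> R).

Lemma charge_jordanE nu (A : set T) : measurable A ->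
  nu A = (charge_pos nu A - charge_neg nu A)%E.
Proof.
move=> mA; rewrite (jordan_decomp (svalP (hahn_pair nu)) mA) /cadd /=.
by rewrite cscaleN1.
Qed.

(** The Jordan parts are minimal: evaluating nu on the two Hahn sets bounds the
    positive part by m1 and the negative part by m2. The integrals then agree
    because positive part + m2 and negative part + m1 are the same measure. *)
Lemma charge_integral_sub nu (m1 m2 : {finite_measure set T -> \bar R}) f :
  (forall A, measurable A -> nu A = (m1 A - m2 A)%E) ->
  m1.-integrable setT (EFin \o f) -> m2.-integrable setT (EFin \o f) ->
  charge_integrable nu f /\
  charge_integral nu f = Rintegral m1 setT f - Rintegral m2 setT f.
Proof.
move=> nuE f1 f2.
have mf : measurable_fun setT (EFin \o f) by case/integrableP: f1.
have posE A : measurable A ->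
    charge_pos nu A = nu (A `&` (sval (hahn_pair nu)).1).
  move=> mA.
  have -> : charge_pos nu A = jordan_pos (svalP (hahn_pair nu)) A by [].
  rewrite jordan_posE cjordan_posE.
  by rewrite /crestr0 mem_set.
have negE A : measurable A ->
    charge_neg nu A = (- nu (A `&` (sval (hahn_pair nu)).2))%E.
  move=> mA.
  have -> : charge_neg nu A = jordan_neg (svalP (hahn_pair nu)) A by [].
  rewrite jordan_negE cjordan_negE.
  by rewrite /crestr0 mem_set.
have [mP mN] : measurable (sval (hahn_pair nu)).1 /\
               measurable (sval (hahn_pair nu)).2.
  by case: (hahn_pair nu) => -[P N] /= [[mP _] [mN _] _ _].
have pos_le A : measurable A -> (charge_pos nu A <= m1 A)%E.
  move=> mA; have mAP : measurable (A `&` (sval (hahn_pair nu)).1).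
    exact: measurableI.
  rewrite posE // nuE //; apply: (@le_trans _ _ (m1 (A `&` (sval (hahn_pair nu)).1))).
    by rewrite geeDl // ?oppe_le0 ?measure_ge0.
  by apply: le_measure; rewrite ?inE //; exact: subIsetl.
have neg_le A : measurable A -> (charge_neg nu A <= m2 A)%E.
  move=> mA; have mAN : measurable (A `&` (sval (hahn_pair nu)).2).
    exact: measurableI.
  rewrite negE // nuE //.
  apply: (@le_trans _ _ (m2 (A `&` (sval (hahn_pair nu)).2))).
    rewrite fin_num_oppeB ?fin_num_measure // addeC.
    by rewrite geeDl // ?oppe_le0 ?measure_ge0.
  by apply: le_measure; rewrite ?inE //; exact: subIsetl.
have mnf : measurable_fun setT (fun x => `|(EFin \o f) x|%E).
  exact: measurableT_comp.
have fpos : (charge_pos nu).-integrable setT (EFin \o f).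
  apply/integrableP; split=> //; case/integrableP: f1 => _.
  by apply: le_lt_trans; apply: ge0_le_measure_integral.
have fneg : (charge_neg nu).-integrable setT (EFin \o f).
  apply/integrableP; split=> //; case/integrableP: f2 => _.
  by apply: le_lt_trans; apply: ge0_le_measure_integral.
split; first by split.
have : (\int[measure_add (charge_pos nu) m2]_x (EFin \o f) x
        = \int[measure_add (charge_neg nu) m1]_x (EFin \o f) x)%E.
  apply: eq_measure_integral => A mA _; rewrite [LHS]measure_addE [RHS]measure_addE.
  suff E : (charge_pos nu A + m2 A = charge_neg nu A + m1 A)%E by exact: E.
  have := nuE A mA; rewrite (charge_jordanE _ mA).
  rewrite -(fineK (fin_num_measure (charge_pos nu) _ mA)).
  rewrite -(fineK (fin_num_measure (charge_neg nu) _ mA)).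
  rewrite -(fineK (fin_num_measure m1 _ mA)) -(fineK (fin_num_measure m2 _ mA)).
  rewrite -!EFinB -!EFinD => -[?]; congr EFin; lra.
rewrite !integral_measure_add //.
have fin (m : {finite_measure set T -> \bar R}) :
    m.-integrable setT (EFin \o f) ->
    (\int[m]_x (EFin \o f) x = (Rintegral m setT f)%:E)%E.
  by move=> fi; rewrite /Rintegral fineK //; apply: integrable_fin_num.
rewrite !fin // -!EFinD => -[?]; rewrite /charge_integral; lra.
Qed.

Lemma charge_integralZ nu (a : R) f : charge_integrable nu f ->
  charge_integrable nu (fun x => a * f x) /\
  charge_integral nu (fun x => a * f x) = a * charge_integral nu f.
Proof.
move=> [fpos fneg]; split.
  by split; [move: fpos|move: fneg] => /(integrableZl measurableT a);
    apply: eq_integrable.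
by rewrite /charge_integral !RintegralZl // mulrBr.
Qed.

End ChargeIntegralTheory.

(** * Atomic approximation of a positive shift-symmetric kernel *)

Section FiniteQuadrature.
Variable C : numClosedFieldType.
Local Open Scope sesquilinear_scope.

Lemma sesquiE n (H : 'M[C]_n) (u v : 'rV[C]_n) :
  (u *m H *m v ^t*) 0 0 = \sum_p \sum_q u 0 p * (v 0 q)^* * H p q.
Proof.
rewrite mxE exchange_big /=; apply: eq_bigr => q _; rewrite !mxE big_distrl /=.
by apply: eq_bigr => p _; rewrite mulrAC.
Qed.

(** The factor is U^* sqrt(D), from the unitary diagonalisation H = U^* D U. *)
Lemma posdef_factor n (H : 'M[C]_n) : H ^t* = H ->
  (forall u : 'rV[C]_n, u != 0 -> 0 < (u *m H *m u ^t*) 0 0) ->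
  exists2 B : 'M[C]_n, B \in unitmx & H = B *m B ^t*.
Proof.
move=> Hsym Hpd.
have Hherm : H \is hermsymmx.
  by apply/is_hermitianmxP; rewrite expr0 scale1r Hsym.
have /orthomx_spectralP HE := hermitian_normalmx Hherm.
set U := spectralmx H in HE; set d := spectral_diag H in HE.
have Uu : U \is unitarymx := spectral_unitarymx H.
have Uunit : U \in unitmx := spectral_unit H.
rewrite invmx_unitary // in HE.
have UU : U *m U ^t* = 1%:M by apply/unitarymxP.
have dE i : d 0 i = (row i U *m H *m (row i U) ^t*) 0 0.
  have -> : row i U *m H *m (row i U) ^t* = delta_mx 0 i *m diag_mx d *m (delta_mx 0 i)^t*.
    rewrite HE rowE !trmx_mul !map_mxM !mulmxA.
    rewrite -[delta_mx 0 i *m U *m U ^t*]mulmxA UU mulmx1.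
    by rewrite -[_ *m U *m U ^t*]mulmxA UU mulmx1.
  rewrite -rowE row_diag_mx mxE (bigD1 i) //= big1 => [|j ji].
    by rewrite !mxE !eqxx addr0 !mulr1 /= conjC1 mulr1.
  by rewrite !mxE (negbTE ji) !andbF mulr0 mul0r.
have dpos i : 0 < d 0 i.
  rewrite dE; apply: Hpd; apply/eqP => rU0.
  have := congr1 (mulmx^~ (U ^t*)) rU0; rewrite rowE -mulmxA UU mulmx1 mul0mx.
  by move/rowP/(_ i)/eqP; rewrite !mxE !eqxx oner_eq0.
exists (U ^t* *m diag_mx (map_mx sqrtC d)).
  rewrite unitmx_mul unitmxE; apply/andP; split.
    by rewrite -unitmxE -invmx_unitary // unitmx_inv.
  rewrite unitmxE det_diag unitfE; apply/prodf_neq0 => i _.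
  by rewrite mxE sqrtC_eq0 gt_eqF.
rewrite trmx_mul map_mxM trmxCK tr_diag_mx map_diag_mx [LHS]HE !mulmxA; congr (_ *m U).
rewrite -mulmxA mulmx_diag; congr (_ *m diag_mx _).
apply/rowP => i; rewrite !mxE. rewrite /= geC0_conj ?sqrtC_ge0 ?ltW //.
by rewrite -expr2 sqrtCK.
Qed.

(** Gauss quadrature by the spectral theorem. In the Hilbert space spanned by
    the first n basis vectors with Gram matrix H, the shift by d, compressed to
    that space, is self-adjoint because h (p + d) q = h p (q + d). Written in the
    coordinates of a factor B of H it is the Hermitian matrix A below: its
    eigenvalues are the atoms, and its powers agree with the iterated shift as
    long as the shifted index stays below n. *)
Lemma atoms_of_posdef (d n : nat) (h : nat -> nat -> C) :
  (forall p q, h q p = (h p q)^*) ->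
  (forall p q, h (p + d)%N q = h p (q + d)%N) ->
  (forall u : 'rV[C]_n, u != 0 ->
     0 < \sum_(p < n) \sum_(q < n) u 0 p * (u 0 q)^* * h p q) ->
  exists (x : 'I_n -> C) (V : 'M[C]_n), (forall r, x r \is Num.real) /\
    forall k (i p q : 'I_n), p = (i + d * k)%N :> nat ->
      h p q = \sum_r x r ^+ k * (V i r * (V q r)^*).
Proof.
move=> hsym hshift hpd.
pose H : 'M[C]_n := \matrix_(p, q) h p q.
pose H' : 'M[C]_n := \matrix_(p, q) h (p + d)%N q.
have Hsym : H ^t* = H by apply/matrixP => p q; rewrite !mxE -hsym.
have H'sym : H' ^t* = H' by apply/matrixP => p q; rewrite !mxE -hsym hshift.
have [|B Bunit HB] := posdef_factor Hsym.
  move=> u u0; rewrite sesquiE.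
  under eq_bigr do under eq_bigr do rewrite mxE.
  exact: hpd.
have B'unit : B ^t* \in unitmx by rewrite map_unitmx unitmx_tr.
pose A := invmx B *m H' *m invmx (B ^t*).
have Aherm : A \is hermsymmx.
  apply/is_hermitianmxP; rewrite expr0 scale1r /A !trmx_mul !map_mxM H'sym.
  by rewrite mulmxA; congr (_ *m _ *m _); rewrite trmx_inv map_invmx ?trmxCK.
have /orthomx_spectralP AE := hermitian_normalmx Aherm.
have /mxOverP xreal := hermitian_spectral_diag_real Aherm.
set U := spectralmx A in AE; set x := spectral_diag A in AE xreal.
have Uu : U \is unitarymx := spectral_unitarymx A.
have UU : U *m U ^t* = 1%:M by apply/unitarymxP.
have U'U : U ^t* *m U = 1%:M.
  by rewrite -invmx_unitary // mulVmx // unitarymx_unit.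
rewrite invmx_unitary // in AE.
pose V := B *m U ^t*.
have HV : H = V *m V ^t*.
  by rewrite HB /V trmx_mul map_mxM trmxCK mulmxA -[_ *m U]mulmxA U'U mulmx1.
have step (p p' : 'I_n) r : p' = (p + d)%N :> nat -> V p' r = V p r * x 0 r.
  move=> pp'.
  have rowH : row p H' = row p' H by apply/rowP => q; rewrite !mxE pp'.
  have : row p (V *m diag_mx x) = row p' V.
    have -> : V *m diag_mx x = B *m A *m U ^t*.
      by rewrite AE /V !mulmxA -[_ *m U *m _]mulmxA UU mulmx1.
    rewrite /A !mulmxA mulmxV // mul1mx !row_mul rowH.
    by rewrite HB /V !row_mul -[_ *m B ^t* *m _]mulmxA mulmxV // mulmx1.
  move=> /rowP/(_ r); rewrite mxE mxE (bigD1 r) //= big1 => [|j jr].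
    by rewrite addr0 !mxE eqxx mulr1n => ->.
  by rewrite !mxE (negbTE jr) mulr0.
have iterV k : forall (i p : 'I_n) r, p = (i + d * k)%N :> nat ->
    V p r = x 0 r ^+ k * V i r.
  elim: k => [|k IHk] i p r pE.
    have -> : p = i by apply: val_inj; rewrite /= pE muln0 addn0.
    by rewrite mul1r.
  have ltk : (i + d * k < n)%N by apply: leq_ltn_trans (ltn_ord p); rewrite pE; lia.
  have pE' : p = (Ordinal ltk + d)%N :> nat by rewrite pE /=; lia.
  by rewrite (step _ _ r pE') (IHk i (Ordinal ltk) r erefl) exprSr mulrAC.
clearbody V.
exists (fun r => x 0 r), V; split=> [r|k i p q pE]; first exact: xreal.
have -> : h p q = H p q by rewrite mxE.
rewrite HV mxE; apply: eq_bigr => r _.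
by rewrite !mxE (iterV k i) // mulrA.
Qed.

End FiniteQuadrature.

Section Approx.
Variable C : numClosedFieldType.

(** The kernel h may be degenerate, so it is perturbed by a multiple of the
    Hankel kernel of the counting measure on n of these nodes. That kernel has
    every shift symmetry, it is strictly positive on n variables since the nodes
    are distinct, and it is bounded by n since they lie between 0 and 1. *)
Definition node (j : nat) : C := j.+1%:R^-1.

Lemma node_real j : (node j)^* = node j.
Proof. by rewrite /node fmorphV rmorph_nat. Qed.

Lemma node_kernel_gram (n : nat) (u : 'rV[C]_n) :
  \sum_(p < n) \sum_(q < n) u 0 p * (u 0 q)^* * \sum_(j < n) node j ^+ (p + q)
  = \sum_(j < n) `|\sum_(p < n) u 0 p * node j ^+ p| ^+ 2.
Proof.
under eq_bigr do under eq_bigr do rewrite mulr_sumr.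
under eq_bigr do rewrite exchange_big /=.
rewrite exchange_big /=; apply: eq_bigr => j _.
rewrite normCK rmorph_sum mulr_suml; apply: eq_bigr => p _.
rewrite mulr_sumr; apply: eq_bigr => q _.
by rewrite rmorphM rmorphXn /= node_real exprD; ring.
Qed.

(** A nonzero polynomial of degree less than n does not vanish at n nodes. *)
Lemma node_kernel_posdef (n : nat) (u : 'rV[C]_n) : u != 0 ->
  0 < \sum_(p < n) \sum_(q < n) u 0 p * (u 0 q)^* *
        \sum_(j < n) node j ^+ (p + q).
Proof.
move=> u0; rewrite node_kernel_gram lt_neqAle sumr_ge0 ?andbT; last first.
  by move=> j _; rewrite exprn_ge0.
apply: contra u0; rewrite eq_sym psumr_eq0; last by move=> j _; rewrite exprn_ge0.
move=> /allP sum0.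
have /eqP : rVpoly u == 0.
  apply: contraT => u_neq0.
  have roots := @max_poly_roots _ _ [seq node j | j <- iota 0 n] u_neq0.
  suff : (size [seq node j | j <- iota 0 n] < size (rVpoly u))%N.
    by rewrite size_map size_iota ltnNge size_poly.
  apply: roots.
    apply/allP => _ /mapP[j + ->]; rewrite mem_iota add0n => /andP[_ jn].
    have := sum0 (Ordinal jn) (mem_index_enum _).
    rewrite implyTb sqrf_eq0 normr_eq0 /= => /eqP E; apply/eqP.
    rewrite -[RHS]E (@horner_coef_wide _ n) ?size_poly //.
    by apply: eq_bigr => p _; rewrite coef_rVpoly_ord.
  rewrite map_inj_uniq ?iota_uniq // => i j /invr_inj /eqP.
  by rewrite eqr_nat eqSS => /eqP.
by move=> /(congr1 (@poly_rV _ n)); rewrite rVpolyK linear0 => ->.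
Qed.

Lemma node_kernel_bound (n p q : nat) :
  `|(n.+1%:R ^+ 2)^-1 * \sum_(j < n) node j ^+ (p + q)| <= n.+1%:R^-1.
Proof.
have node_ge0 j : 0 <= node j by rewrite invr_ge0 ler0n.
have node_le1 j : node j <= 1 by rewrite invf_le1 ?ltr0Sn // ler1n.
have S0 : 0 <= \sum_(j < n) node j ^+ (p + q).
  by apply: sumr_ge0 => j _; rewrite exprn_ge0.
rewrite ger0_norm; last by rewrite mulr_ge0 // invr_ge0 exprn_ge0.
have Sn : \sum_(j < n) node j ^+ (p + q) <= n.+1%:R.
  apply: (@le_trans _ _ (\sum_(j < n) 1)).
    by apply: ler_sum => j _; rewrite exprn_ile1.
  by rewrite sumr_const card_ord ler_nat.
rewrite expr2 invfM -mulrA ler_piMr ?invr_ge0 //.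
by rewrite mulrC ler_pdivrMr ?mul1r // ltr0Sn.
Qed.

(** The error is the perturbation itself, as the quadrature is exact for the
    perturbed kernel. *)
Lemma approx_atoms (d : nat) (h : nat -> nat -> C) :
  (forall p q, h q p = (h p q)^*) ->
  (forall p q, h (p + d)%N q = h p (q + d)%N) ->
  (forall n (u : 'rV[C]_n),
     0 <= \sum_(p < n) \sum_(q < n) u 0 p * (u 0 q)^* * h p q) ->
  forall n, exists (x : 'I_n -> C) (V : 'M[C]_n), (forall r, x r \is Num.real) /\
    forall k (i p q : 'I_n), p = (i + d * k)%N :> nat ->
      `|\sum_r x r ^+ k * (V i r * (V q r)^*) - h p q| <= n.+1%:R^-1.
Proof.
move=> hsym hshift hpsd n.
pose e : C := (n.+1%:R ^+ 2)^-1.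
have e0 : 0 < e by rewrite invr_gt0 exprn_gt0 // ltr0Sn.
pose h' p q := h p q + e * \sum_(j < n) node j ^+ (p + q).
have [p q|p q|u u0|x [V [xreal VE]]] := @atoms_of_posdef C d n h'.
- rewrite /h' hsym rmorphD rmorphM rmorph_sum /= /e fmorphV rmorphXn rmorph_nat.
  congr (_ + _ * _); apply: eq_bigr => j _.
  by rewrite rmorphXn /= node_real addnC.
- by rewrite /h' hshift addnAC addnA.
- rewrite /h'; under eq_bigr do under eq_bigr do rewrite mulrDr.
  under eq_bigr do rewrite big_split; rewrite big_split /=.
  apply: ltr_wpDl; first exact: hpsd.
  under eq_bigr do under eq_bigr do rewrite mulrCA.
  under eq_bigr do rewrite -mulr_sumr.
  by rewrite -mulr_sumr mulr_gt0 // node_kernel_posdef.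
exists x, V; split=> // k i p q pE.
rewrite -(VE k i p q) // /h' addrAC subrr add0r; exact: node_kernel_bound.
Qed.

End Approx.

(** * Step functions approximating monomials *)

Section StepApproximation.
Context {R : realType}.
Implicit Types (x : R) (N j k K : nat).

Lemma step_sum_cases (t a : nat -> R) K x : {homo t : i j / (i <= j)%N >-> i <= j} ->
  (exists2 j, t j < x <= t j.+1 &
     \sum_(j < K) a j * \1_(`]t j, t j.+1]) x = a j) \/
  ((x <= t 0%N) || (t K < x)) /\ \sum_(j < K) a j * \1_(`]t j, t j.+1]) x = 0.
Proof.
move=> tmono; elim: K => [|K IHK].
  by right; rewrite big_ord0; split=> //; rewrite leNgt orNb.
rewrite big_ord_recr /=.
have E : \1_(`]t K, t K.+1]) x = (t K < x <= t K.+1)%R%:R :> R.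
  rewrite indicE; congr (nat_of_bool _)%:R.
  by apply/idP/idP; rewrite inE /= in_itv.
rewrite E; case: (boolP (t K < x <= t K.+1)) => [/andP[tKx xtK]|ntK].
- left; exists K; first by rewrite tKx.
  suff -> : \sum_(j < K) a j * \1_(`]t j, t j.+1]) x = 0 by rewrite add0r mulr1.
  apply: big1 => j _; rewrite indicE memNset ?mulr0 //= in_itv /=.
  by apply/negP; rewrite negb_and -leNgt -ltNge (le_lt_trans _ tKx) ?orbT // tmono.
- rewrite mulr0 addr0; case: IHK => [[j tj sumE]|[out sum0]]; first by left; exists j.
  right; split=> //; case/orP: out => [->//|tKx].
  by move: ntK; rewrite negb_and -leNgt -ltNge (leNgt _ (t K)) tKx /= => ->; rewrite orbT.
Qed.

Lemma expr_dist_le (a b M : R) k : `|a| <= M -> `|b| <= M -> 1 <= M ->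
  `|a ^+ k - b ^+ k| <= `|a - b| * k%:R * M ^+ k.
Proof.
move=> aM bM M1; have M0 : 0 <= M by apply: le_trans M1.
elim: k => [|k IHk]; first by rewrite !expr0 subrr normr0 mulr0 mul0r.
have -> : a ^+ k.+1 - b ^+ k.+1 = a * (a ^+ k - b ^+ k) + (a - b) * b ^+ k.
  by rewrite !exprS; ring.
apply: (le_trans (ler_normD _ _)); rewrite !normrM normrX.
have H1 : `|a| * `|a ^+ k - b ^+ k| <= M * (`|a - b| * k%:R * M ^+ k).
  by apply: ler_pM.
have H2 : `|a - b| * `|b| ^+ k <= `|a - b| * M ^+ k.+1.
  rewrite ler_wpM2l // exprS; apply: (@le_trans _ _ (M ^+ k)).
    by rewrite lerXn2r // nnegrE.
  by rewrite ler_peMl // exprn_ge0.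
apply: (le_trans (lerD H1 H2)).
by rewrite le_eqVlt; apply/orP; left; apply/eqP; rewrite -natr1 exprS; ring.
Qed.

(** The weight dominating all the estimates: a polynomial, so that its
    integrals are moments. *)
Definition weight n x : R := 1 + x ^+ (2 * n).

Lemma weight_ge1 n x : 1 <= weight n x.
Proof. by rewrite lerDl exprM exprn_ge0 // sqr_ge0. Qed.

Lemma expr_le_weight n x : (`|x| + 2) ^+ n <= 4 ^+ n * weight n x.
Proof.
have [x1|x1] := leP `|x| 1.
  apply: (@le_trans _ _ (4 ^+ n)); last by rewrite ler_peMr ?weight_ge1 ?exprn_ge0.
  by rewrite lerXn2r ?nnegrE //; lra.
have -> : weight n x = 1 + `|x| ^+ n * `|x| ^+ n.
  by rewrite /weight mulnC exprM -exprMn -expr2 real_normK ?num_real // -exprM mulnC exprM.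
have xn : 1 <= `|x| ^+ n by rewrite exprn_ege1 // ltW.
apply: (@le_trans _ _ ((4 * `|x|) ^+ n)).
  by rewrite lerXn2r ?nnegrE //; lra.
rewrite exprMn ler_wpM2l ?exprn_ge0 //; nra.
Qed.

Definition grid N j : R := j%:R / N.+1%:R - N.+1%:R.

Lemma grid_homo N : {homo grid N : i j / (i <= j)%N >-> i <= j}.
Proof. by move=> i j ij; rewrite lerD2r ler_pM2r ?invr_gt0 ?ltr0Sn // ler_nat. Qed.

Lemma gridS N j : grid N j.+1 = grid N j + N.+1%:R^-1.
Proof. by rewrite /grid -natr1 mulrDl mul1r addrAC. Qed.

Lemma grid_last N : grid N (2 * N.+1 ^ 2) = N.+1%:R.
Proof.
rewrite /grid natrM natrX; have : N.+1%:R != 0 :> R by rewrite pnatr_eq0.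
by move: (N.+1%:R : R) => u u0; field.
Qed.

Definition step_error k : R := (2 * k%:R + 1) * 4 ^+ k.+1.

(** On a cell the grid point is within 2 / (N + 1) of x. Off the grid the step
    function is 0, but there |x| + 2 is at least N + 1, so one more power of
    |x| + 2 pays for the value that is lost. The shift by eta is there because
    the distribution function of the measure built below is only a right limit. *)
Lemma step_approx N k (eta x : R) : 0 <= eta <= N.+1%:R^-1 ->
  `|\sum_(j < 2 * N.+1 ^ 2) grid N j ^+ k *
      \1_(`](grid N j + eta), (grid N j.+1 + eta)]) x - x ^+ k|
  <= N.+1%:R^-1 * (step_error k * weight k.+1 x).
Proof.
move=> /andP[eta0 etaN]; set D := N.+1%:R^-1 in etaN *.
have N0 : 0 < N.+1%:R :> R by rewrite ltr0Sn.
have D0 : 0 < D by rewrite invr_gt0.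
have D1 : D <= 1 by rewrite invf_le1 // ler1n.
suff main : `|\sum_(j < 2 * N.+1 ^ 2) grid N j ^+ k *
      \1_(`](grid N j + eta), (grid N j.+1 + eta)]) x - x ^+ k|
      <= D * ((2 * k%:R + 1) * (`|x| + 2) ^+ k.+1).
  apply: (le_trans main); rewrite ler_pM2l // /step_error -mulrA.
  by rewrite ler_wpM2l ?expr_le_weight // addr_ge0 // mulr_ge0.
have hmono : {homo (fun j => grid N j + eta) : i j / (i <= j)%N >-> i <= j}.
  by move=> i j ij; rewrite lerD2r grid_homo.
have M1 : 1 <= `|x| + 2 by have := normr_ge0 x; lra.
have Mk : 0 <= (`|x| + 2) ^+ k by rewrite exprn_ge0 //; lra.
have [[j /andP[lo hi] ->]|[out ->]] :=
  step_sum_cases (fun j => grid N j ^+ k) (2 * N.+1 ^ 2) x hmono.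
  rewrite gridS -/D in hi.
  have dist : `|grid N j - x| <= 2 * D by rewrite ler_norml; lra.
  have gM : `|grid N j| <= `|x| + 2.
    have := ler_normD (grid N j - x) x; rewrite subrK; lra.
  have xM : `|x| <= `|x| + 2 by lra.
  apply: (le_trans (expr_dist_le k gM xM M1)).
  apply: (@le_trans _ _ (2 * D * k%:R * (`|x| + 2) ^+ k)).
    by rewrite -!(mulrA _ k%:R) ler_wpM2r // mulr_ge0.
  have -> : 2 * D * k%:R * (`|x| + 2) ^+ k = D * (2 * k%:R * (`|x| + 2) ^+ k).
    by ring.
  rewrite ler_pM2l // exprS mulrA ler_wpM2r //.
  have k0 : 0 <= k%:R :> R by [].
  nra.
have xbig : 1 <= D * (`|x| + 2).
  apply: (@le_trans _ _ (D * N.+1%:R)); first by rewrite mulVf ?lt0r_neq0.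
  rewrite ler_pM2l //.
  case/orP: out.
    rewrite /grid mul0r add0r => xle; have := ler_norm (- x); rewrite normrN; lra.
  rewrite grid_last => xgt; have := ler_norm x; lra.
rewrite sub0r normrN normrX.
apply: (@le_trans _ _ ((`|x| + 2) ^+ k)).
  by rewrite lerXn2r ?nnegrE //; have := normr_ge0 x; lra.
apply: (@le_trans _ _ ((D * (`|x| + 2)) * (`|x| + 2) ^+ k)).
  by rewrite ler_peMl.
rewrite -mulrA -exprS ler_pM2l //.
have Mk1 : 0 <= (`|x| + 2) ^+ k.+1 by rewrite exprn_ge0 //; lra.
by rewrite ler_peMl // lerDr mulr_ge0.
Qed.

End StepApproximation.

(** * Riemann sums of monomials *)

Section RiemannSums.
Context {R : realType}.
Local Notation T := (measurableTypeR R).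
Implicit Types (m : {finite_measure set T -> \bar R}) (k N K : nat).

Lemma measurable_expr k : measurable_fun [set: T] (fun x : T => x ^+ k : R).
Proof. exact: measurable_funX. Qed.

Lemma fine_measure_oc m (a b : R) : a <= b -> fine (m `]a, b]%classic)
  = fine (m `]-oo, b]%classic) - fine (m `]-oo, a]%classic).
Proof.
move=> ab; have mA (i : interval R) : measurable ([set` i] : set T).
  exact: measurable_itv.
have -> : m `]-oo, b]%classic = (m `]-oo, a]%classic + m `]a, b]%classic)%E.
  rewrite -measureU //; first by rewrite -itv_bndbnd_setU // bnd_simp.
  apply/seteqP; split => // x [] /=; rewrite !in_itv /= => xl /andP[+ _].
  by rewrite ltNge xl.
by rewrite fineD ?fin_num_measure // addrC addKr.
Qed.

Lemma step_integral m (t a : nat -> R) K :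
  m.-integrable setT
    (EFin \o (fun x : T => \sum_(j < K) a j * \1_(`]t j, t j.+1]) x)) /\
  Rintegral m setT (fun x : T => \sum_(j < K) a j * \1_(`]t j, t j.+1]) x)
  = \sum_(j < K) a j * fine (m `]t j, t j.+1]%classic).
Proof.
have indI (A : set T) c : measurable A ->
    m.-integrable setT (EFin \o (fun x => c * \1_A x)).
  by move=> mA; exact: (integrableZl measurableT c (integrable_indic m mA)).
elim: K => [|K [IHi IHe]].
  split; first by under eq_fun do rewrite big_ord0; exact: finite_measure_integrable_cst.
  by under eq_Rintegral do rewrite big_ord0; rewrite Rintegral_cst // mul0r big_ord0.
have E : (fun x : T => \sum_(j < K.+1) a j * \1_(`]t j, t j.+1]) x) =
    (fun x : T => \sum_(j < K) a j * \1_(`]t j, t j.+1]) x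
                  + a K * \1_(`]t K, t K.+1]) x).
  by apply/funext => x; rewrite big_ord_recr.
rewrite E; have mA : measurable (`]t K, t K.+1]%classic : set T) by exact: measurable_itv.
split.
  have := integrableD measurableT IHi (indI _ (a K) mA).
  by apply: eq_integrable.
rewrite RintegralD //; last exact: indI.
rewrite IHe big_ord_recr /= RintegralZl //; last first.
  by have := indI _ 1 mA; apply: eq_integrable => // x _ /=; rewrite mul1r.
by rewrite /Rintegral integral_indic // setIT.
Qed.

Section Moments.
Variable m : {finite_measure set T -> \bar R}.
Hypothesis mom : forall k, m.-integrable setT (EFin \o (fun x : T => x ^+ k : R)).

Lemma weight_integrable n : m.-integrable setT (EFin \o (weight n : T -> R)).
Proof.
have := integrableD measurableT (mom 0) (mom (2 * n)).
by apply: eq_integrable => // x _ /=; rewrite expr0.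
Qed.

(** The pointwise bound of step_approx, integrated. *)
Lemma riemann_sum_dist k N :
  `|\sum_(j < 2 * N.+1 ^ 2) grid N j ^+ k * fine (m `]grid N j, grid N j.+1]%classic)
    - Rintegral m setT (fun x : T => x ^+ k)|
  <= N.+1%:R^-1 * (step_error k * Rintegral m setT (weight k.+1 : T -> R)).
Proof.
have [gi <-] := step_integral m (grid N) (fun j => grid N j ^+ k) (2 * N.+1 ^ 2).
set g := (fun x : T => _) in gi *.
have wi := weight_integrable k.+1.
have di : m.-integrable setT (EFin \o (fun x : T => g x - x ^+ k)).
  by have := integrableB measurableT gi (mom k); apply: eq_integrable.
rewrite -RintegralB //; last exact: mom.
apply: (le_trans (le_normr_Rintegral measurableT di)).
rewrite -RintegralZl // -RintegralZl //; last first.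
  by have := integrableZl measurableT (step_error k) wi; apply: eq_integrable.
apply: le_Rintegral => //.
- exact: (integrable_norm di).
- have := integrableZl measurableT N.+1%:R^-1
    (integrableZl measurableT (step_error k) wi).
  by apply: eq_integrable.
move=> x _; have := @step_approx R N k 0 x.
rewrite lexx invr_ge0 ler0n => /(_ isT).
by under eq_bigr do rewrite !addr0.
Qed.

Lemma riemann_sum_cvg k :
  (\sum_(j < 2 * N.+1 ^ 2) grid N j ^+ k * fine (m `]grid N j, grid N j.+1]%classic))
    @[N --> \oo] --> Rintegral m setT (fun x : T => x ^+ k).
Proof.
apply/cvgrPdist_lt => /= e e0.
set c := step_error k * Rintegral m setT (weight k.+1 : T -> R).
have /cvgrPdist_lt /(_ e e0) : (N.+1%:R^-1 * c) @[N --> \oo] --> (0 : R).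
  rewrite -(mul0r c); apply: cvgMr_tmp; exact: cvg_harmonic.
apply: filterS => N; rewrite sub0r normrN => /(le_lt_trans (ler_norm _)).
by apply: le_lt_trans; rewrite distrC; exact: riemann_sum_dist.
Qed.

End Moments.

Lemma charge_riemann_cvg (nu : {charge set T -> \bar R}) :
  (forall k, charge_integrable nu (fun x : T => x ^+ k : R)) ->
  forall k,
  (\sum_(j < 2 * N.+1 ^ 2) grid N j ^+ k * fine (nu `]grid N j, grid N j.+1]%classic))
    @[N --> \oo] --> charge_integral nu (fun x : T => x ^+ k).
Proof.
move=> mom k.
have posc := @riemann_sum_cvg (charge_pos nu) (fun k => (mom k).1) k.
have negc := @riemann_sum_cvg (charge_neg nu) (fun k => (mom k).2) k.
suff -> : (fun N => \sum_(j < 2 * N.+1 ^ 2)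
                      grid N j ^+ k * fine (nu `]grid N j, grid N j.+1]%classic))
  = (fun N => \sum_(j < 2 * N.+1 ^ 2)
                 grid N j ^+ k * fine (charge_pos nu `]grid N j, grid N j.+1]%classic)
      - \sum_(j < 2 * N.+1 ^ 2)
                 grid N j ^+ k * fine (charge_neg nu `]grid N j, grid N j.+1]%classic)).
  exact: cvgB posc negc.
apply/funext => N; rewrite -sumrB; apply: eq_bigr => j _; rewrite -mulrBr.
have mA : measurable (`]grid N j, grid N j.+1]%classic : set T) by exact: measurable_itv.
by congr (_ * _); rewrite [in LHS]charge_jordanE // fineB // fin_num_measure.
Qed.

End RiemannSums.

(** * The measure of a right limit *)

Section RightLimitMeasure.
Context {R : realType}.
Local Notation T := (measurableTypeR R).

Lemma cumulative_right_limit (F : R -> R) : {homo F : x y / x <= y} ->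
  (exists b, forall x, b <= F x) ->
  exists2 G : cumulative R R, (forall x, F y @[y --> x^'+] --> G x) &
    forall x y, x < y -> F x <= G x <= F y.
Proof.
move=> Fmono [b Fb].
pose G x := inf [set F y | y in `]x, +oo[].
have GF x y : x < y -> G x <= F y.
  move=> xy; apply: ge_inf; first by exists b => _ [z _ <-].
  by exists y => //=; rewrite in_itv /= xy.
have lower x (c : R) : (forall y, x < y -> c <= F y) -> c <= G x.
  move=> cF; apply: lb_le_inf.
    by exists (F (x + 1)), (x + 1) => //=; rewrite in_itv /= ltrDl ltr01.
  by move=> z [y /=]; rewrite in_itv /= andbT => xy <-; exact: cF.
have Glim x : F y @[y --> x^'+] --> G x.
  apply: nondecreasing_at_right_cvgr => //.
    by move=> y z _ _; exact: Fmono.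
  by exists b => _ [z _ <-].
have Gmono : {homo G : x y / x <= y}.
  move=> x y xy; apply: lower => z yz; apply: GF; exact: le_lt_trans yz.
have Grc : right_continuous G.
  move=> x; apply/cvgrPdist_lt => e e0.
  have /cvgrPdist_lt/(_ e e0) near_x := Glim x.
  near=> z.
  have xz : x < z by near: z; exact: nbhs_right_gt.
  rewrite distrC ger0_norm ?subr_ge0 ?Gmono ?(ltW xz) //.
  have Fz : `|G x - F z| < e by near: z.
  near: z.
  case: near_x => d /= d0 Hd.
  exists (d / 2); first by rewrite /= divr_gt0.
  move=> z /=; rewrite distrC => dz xz.
  have zd : 0 < z - x < d / 2.
    by rewrite subr_gt0 xz /=; apply: le_lt_trans dz; exact: ler_norm.
  (* G z is at most F at any point beyond z; this one is still within d of x. *)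
  have := Hd (x + 2 * (z - x)) _ _ => /=.
  have -> : `|x - (x + 2 * (z - x))| < d.
    rewrite opprD addNKr normrN ger0_norm; last by lra.
    lra.
  have -> : x < x + 2 * (z - x) by lra.
  move=> /(_ isT isT) H.
  have := GF z (x + 2 * (z - x)); have : z < x + 2 * (z - x) by lra.
  move=> -> /(_ isT) H2.
  by move: H; rewrite ltr_norml; lra.
pose Gc : cumulative R R := HB.pack G (isCumulative.Build R _ R G Gmono Grc).
exists Gc; first exact: Glim.
move=> x y xy; rewrite GF // andbT; apply: lower => z xz; apply: Fmono; exact: ltW.
Unshelve. all: by end_near. Qed.

(** Boundedness makes the Lebesgue-Stieltjes measure of the right limit finite;
    the infimum 0 makes its distribution function the right limit itself and
    not a translate of it. *)
Lemma right_limit_measure (F : R -> R) (B : R) : {homo F : x y / x <= y} ->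
  (forall x, 0 <= F x <= B) -> (forall e, 0 < e -> exists x, F x < e) ->
  exists m : {finite_measure set T -> \bar R},
    forall x, F y @[y --> x^'+] --> fine (m `]-oo, x]%classic).
Proof.
move=> Fmono FB Finf.
have [|G Glim GF] := cumulative_right_limit Fmono.
  by exists 0 => x; case/andP: (FB x).
have G0 x : 0 <= G x.
  have /andP[+ _] := GF x (x + 1) (ltr_pwDr ltr01 (lexx x)).
  by apply: le_trans; case/andP: (FB x).
have GB x : G x <= B.
  have /andP[_] := GF x (x + 1) (ltr_pwDr ltr01 (lexx x)).
  by move=> /le_trans; apply; case/andP: (FB (x + 1)).
pose mu := lebesgue_stieltjes_measure G.
have muoc a b : a <= b -> mu `]a, b]%classic = (G b - G a)%:E.
  move=> ab; rewrite /mu /lebesgue_stieltjes_measure /measure_extension.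
  rewrite measurable_mu_extE /=; last exact: is_ocitv.
  by rewrite wlength_itv_bnd.
have mufin : fin_num_fun mu.
  have muT : (mu setT <= B%:E)%E.
    rewrite -(bigcup_itvT false false).
    pose I n : set R := `]- (n%:R), n%:R]%classic.
    have H : (mu \o I) n @[n --> \oo] --> mu (\bigcup_n I n).
      apply: nondecreasing_cvg_mu; rewrite /I//; first exact: bigcup_measurable.
      by move=> *; apply/subsetPset/subset_itv; rewrite leBSide/= ?lerN2 ler_nat.
    rewrite -(cvg_lim _ H) //; apply: lime_le; first by apply/cvg_ex; exists (mu (\bigcup_n I n)).
    apply: nearW => n; rewrite /= muoc; last by rewrite (@le_trans _ _ 0) // oppr_le0.
    by rewrite lee_fin; have := GB n%:R; have := G0 (- n%:R); lra.
  move=> A mA; rewrite fin_real //; apply/andP; split.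
    exact: (lt_le_trans _ (measure_ge0 _ _)).
  apply: (@le_lt_trans _ _ B%:E); last exact: ltry.
  apply: le_trans muT; apply: le_measure; rewrite ?inE //; exact: measurableT.
pose m : {finite_measure set T -> \bar R} :=
  HB.pack mu (Measure_isFinite.Build _ _ _ mu mufin).
exists m => x; rewrite (_ : fine _ = G x); first exact: Glim.
suff H : mu `]-oo, x]%classic = (G x)%:E by rewrite [m _]H.
rewrite itvNybndEbigcup.
pose I k : set R := `]- (k%:R), x]%classic.
have H : (mu \o I) n @[n --> \oo] --> mu (\bigcup_n I n).
  apply: nondecreasing_cvg_mu; rewrite /I//; first exact: bigcup_measurable.
  by move=> *; apply/subsetPset/subset_itv; rewrite leBSide/= ?lerN2 ?ler_nat.
rewrite -(cvg_lim _ H) //; apply: cvg_lim => //.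
have muI : \forall k \near \oo, (mu \o I) k = (G x - G (- k%:R))%:E.
  near=> k; rewrite /= muoc //.
  by rewrite lerNl ltW //; near: k; exact: nbhs_infty_gtr.
apply/fine_cvgP; split; first by apply: filterS muI => k ->.
have GxB : (G x - G (- k%:R)) @[k --> \oo] --> G x.
  apply/cvgrPdist_lt => e e0; have [a Fa] := Finf e e0.
  near=> k; rewrite subKr ger0_norm //.
  apply: le_lt_trans Fa.
  have ka : - k%:R < a by rewrite ltrNl; near: k; exact: nbhs_infty_gtr.
  by have /andP[_] := GF _ _ ka.
apply: cvg_trans GxB; apply: near_eq_cvg.
by apply: filterS muI => k /= ->.
Unshelve. all: by end_near. Qed.

End RightLimitMeasure.

(** * Representation of positive functionals *)

Section PositiveFunctional.
Context {R : realType}.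
Local Notation T := (measurableTypeR R).

Lemma cvg_sumr (I U : Type) (r : seq I) (F : set_system U) {FF : Filter F}
    (f : I -> U -> R) (l : I -> R) : (forall i, f i x @[x --> F] --> l i) ->
  \sum_(i <- r) f i x @[x --> F] --> \sum_(i <- r) l i.
Proof.
move=> fl; elim: r => [|i r IHr].
  by rewrite big_nil; under eq_fun do rewrite big_nil; exact: cvg_cst.
by rewrite big_cons; under eq_fun do rewrite big_cons; exact: cvgD.
Qed.

Definition poly_bounded (f : R -> R) :=
  exists c n, forall x, `|f x| <= c * weight n x.

(** A limit of integrals against discrete measures with convergent moments is
    such a functional: it is defined on all functions dominated by a polynomial,
    indicators included. *)
Definition positive_functional (L : (R -> R) -> R) :=
  (forall a f g, poly_bounded f -> poly_bounded g ->
     L (fun x => a * f x + g x) = a * L f + L g) /\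
  (forall f, poly_bounded f -> (forall x, 0 <= f x) -> 0 <= L f).

Lemma weight_gt0 n (x : R) : 0 < weight n x.
Proof. by apply: lt_le_trans (weight_ge1 n x). Qed.

Lemma weight_leD n n' (x : R) : weight n x <= 2 * weight (n + n') x.
Proof.
rewrite /weight !exprM exprD; set y := x ^+ 2.
have y0 : 0 <= y by exact: sqr_ge0.
have a0 : 0 <= y ^+ n by rewrite exprn_ge0.
have b0 : 0 <= y ^+ n' by rewrite exprn_ge0.
have [y1|y1] := leP y 1; first by have := exprn_ile1 n y0 y1; nra.
by have := exprn_ege1 n' (ltW y1); nra.
Qed.

Lemma poly_bounded_lin (a : R) f g : poly_bounded f -> poly_bounded g ->
  poly_bounded (fun x => a * f x + g x).
Proof.
move=> [c [n fc]] [c' [n' gc]].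
exists (2 * `|a| * c + 2 * c'), (n + n')%N => x.
have cpos (e : R) k (h : R -> R) : (forall x, `|h x| <= e * weight k x) -> 0 <= e.
  move=> /(_ 0) H; have := le_trans (normr_ge0 _) H.
  by rewrite pmulr_lge0 // weight_gt0.
have c0 := cpos _ _ _ fc; have c'0 := cpos _ _ _ gc.
apply: (le_trans (ler_normD _ _)); rewrite normrM mulrDl; apply: lerD.
  rewrite -[2 * `|a|]mulrC -!mulrA ler_wpM2l //.
  by apply: (le_trans (fc x)); rewrite mulrCA ler_wpM2l // weight_leD.
apply: (le_trans (gc x)); rewrite (mulrC 2) -mulrA ler_wpM2l //.
by rewrite addnC weight_leD.
Qed.

Lemma poly_bounded_bounded (f : R -> R) (c : R) : (forall x, `|f x| <= c) ->
  poly_bounded f.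
Proof.
move=> fc; exists c, 0%N => x; apply: le_trans (fc x) _.
by rewrite ler_peMr ?weight_ge1 // (le_trans _ (fc 0)).
Qed.

Lemma poly_bounded_weight n : poly_bounded (weight n).
Proof. by exists 1, n => x; rewrite mul1r ger0_norm // ltW // weight_gt0. Qed.

Lemma poly_bounded_expr n : poly_bounded (fun x => x ^+ n).
Proof.
exists (4 ^+ n), n => x; apply: le_trans (expr_le_weight n x).
by rewrite normrX lerXn2r ?nnegrE ?addr_ge0 // lerDl.
Qed.

Lemma poly_bounded_indic (A : set R) : poly_bounded \1_A.
Proof.
apply: (@poly_bounded_bounded _ 1) => x; rewrite indicE normr_nat.
by rewrite lern1; case: (_ \in _).
Qed.

Section Functional.
Variable L : (R -> R) -> R.
Hypothesis Lpos : positive_functional L.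

Let poly_bounded0 : poly_bounded (fun=> 0 : R).
Proof. by apply: (@poly_bounded_bounded _ 0) => x; rewrite normr0. Qed.

Lemma functional0 : L (fun=> 0) = 0.
Proof.
have := Lpos.1 (-1) _ _ poly_bounded0 poly_bounded0.
under eq_fun do rewrite mulr0 addr0.
by rewrite mulN1r addNr.
Qed.

Lemma functionalZ a f : poly_bounded f -> L (fun x => a * f x) = a * L f.
Proof.
move=> fb; have := Lpos.1 a _ _ fb poly_bounded0.
by under eq_fun do rewrite addr0; rewrite functional0 addr0.
Qed.

Lemma functionalB f g : poly_bounded f -> poly_bounded g ->
  L (fun x => f x - g x) = L f - L g.
Proof.
move=> fb gb; have := Lpos.1 (-1) _ _ gb fb.
under eq_fun do rewrite mulN1r addrC; by rewrite mulN1r addrC.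
Qed.

Lemma functional_sum (I : Type) (r : seq I) (a : I -> R) (f : I -> R -> R) :
  (forall i, poly_bounded (f i)) ->
  poly_bounded (fun x => \sum_(i <- r) a i * f i x) /\
  L (fun x => \sum_(i <- r) a i * f i x) = \sum_(i <- r) a i * L (f i).
Proof.
move=> fb; elim: r => [|i r [IHb IHe]].
  by under eq_fun do rewrite big_nil; rewrite functional0 big_nil.
under eq_fun do rewrite big_cons; rewrite big_cons -IHe.
by split; [exact: poly_bounded_lin|exact: Lpos.1].
Qed.

Lemma functional_le f g : poly_bounded f -> poly_bounded g ->
  (forall x, f x <= g x) -> L f <= L g.
Proof.
move=> fb gb fg; rewrite -subr_ge0 -functionalB //; apply: Lpos.2.
  have := poly_bounded_lin (-1) fb gb.
  by under eq_fun do rewrite mulN1r addrC.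
by move=> x; rewrite subr_ge0.
Qed.

Lemma functional_dist_le f g w : poly_bounded f -> poly_bounded g ->
  poly_bounded w -> (forall x, `|f x - g x| <= w x) -> `|L f - L g| <= L w.
Proof.
move=> fb gb wb fgw.
have db : poly_bounded (fun x => f x - g x).
  have := poly_bounded_lin (-1) gb fb.
  by under eq_fun do rewrite mulN1r addrC.
have nwb : poly_bounded (fun x => - w x).
  have := poly_bounded_lin (-1) wb poly_bounded0.
  by under eq_fun do rewrite mulN1r addr0.
rewrite -functionalB // ler_norml; apply/andP; split.
  rewrite -mulN1r -functionalZ //; apply: functional_le => //.
    by under eq_fun do rewrite mulN1r.
  by move=> x; have := fgw x; rewrite mulN1r ler_norml => /andP[].
by apply: functional_le => // x; have := fgw x; rewrite ler_norml => /andP[].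
Qed.

Let F y := L \1_(`]-oo, y]%classic).

Let indic_itv (y x : R) : \1_(`]-oo, y]%classic) x = (x <= y)%R%:R :> R.
Proof. by rewrite indicE; congr (nat_of_bool _)%:R; apply/idP/idP; rewrite inE /= in_itv. Qed.

Let F_homo : {homo F : x y / x <= y}.
Proof.
move=> x y xy; apply: functional_le; try exact: poly_bounded_indic.
move=> z; rewrite !indic_itv ler_nat.
by have [/le_trans/(_ xy) ->|] := leP z x.
Qed.

Let F_bound y : 0 <= F y <= L (weight 0).
Proof.
apply/andP; split.
  by apply: Lpos.2 => [|x]; [exact: poly_bounded_indic|rewrite indic_itv].
apply: functional_le; [exact: poly_bounded_indic|exact: poly_bounded_weight|].
by move=> x; apply: le_trans (weight_ge1 _ _); rewrite indic_itv lern1; case: (_ <= _).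
Qed.

(** Chebyshev: the indicator of the half-line below - y is at most weight 1 / y. *)
Let F_inf e : 0 < e -> exists y, F y < e.
Proof.
move=> e0; set c := L (weight 1).
have c0 : 0 <= c.
  by apply: Lpos.2 => [|x]; [exact: poly_bounded_weight|rewrite ltW // weight_gt0].
pose y := 1 + c / e; have y1 : 1 <= y by rewrite lerDl divr_ge0 // ltW.
exists (- y).
have : y * F (- y) <= c.
  rewrite /F -functionalZ; last exact: poly_bounded_indic.
  apply: functional_le; [|exact: poly_bounded_weight|].
    have := poly_bounded_lin y (@poly_bounded_indic `]-oo, - y]%classic) poly_bounded0.
    by under eq_fun do rewrite addr0.
  move=> x; rewrite indic_itv /weight muln1.
  by have [xy|_] := leP x (- y); rewrite ?mulr1 ?mulr0; nra.
have := F_bound (- y); case/andP => F0 _ yF.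
rewrite ltNge; apply/negP => eF.
have : y * e <= c by apply: le_trans yF; rewrite ler_pM2l //; lra.
by rewrite /y mulrDl mul1r -mulrA mulVf ?gt_eqF //; lra.
Qed.

(** The step sums against the measure are limits, as eta decreases to 0, of the
    values of the functional at step functions with jumps shifted by eta. *)
Let step_value (N : nat) (eta : R) (k : nat) :
  L (fun x => \sum_(j < 2 * N.+1 ^ 2) grid N j ^+ k *
      \1_(`](grid N j + eta), (grid N j.+1 + eta)]%classic) x)
  = \sum_(j < 2 * N.+1 ^ 2) grid N j ^+ k *
      (F (grid N j.+1 + eta) - F (grid N j + eta)).
Proof.
have [_ ->] := functional_sum (index_enum _)
  (fun j : 'I_(2 * N.+1 ^ 2) => grid N j ^+ k)
  (fun j => @poly_bounded_indic `](grid N j + eta), (grid N j.+1 + eta)]%classic).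
apply: eq_bigr => j _; congr (_ * _).
rewrite /F -functionalB; try exact: poly_bounded_indic.
congr L; apply/funext => x; rewrite !indic_itv indicE.
have -> : (x \in `](grid N j + eta), (grid N j.+1 + eta)]%classic)
    = (grid N j + eta < x <= grid N j.+1 + eta).
  by apply/idP/idP; rewrite inE /= in_itv.
have gg : grid N j <= grid N j.+1 :> R by apply: grid_homo.
have [x1|x1] := leP x (grid N j + eta); have [x2|x2] := leP x (grid N j.+1 + eta);
  rewrite /= ?subrr ?subr0 //; lra.
Qed.

Let step_value_dist (N : nat) (eta : R) (k : nat) : 0 <= eta <= N.+1%:R^-1 ->
  `|\sum_(j < 2 * N.+1 ^ 2) grid N j ^+ k *
      (F (grid N j.+1 + eta) - F (grid N j + eta)) - L (fun x => x ^+ k)|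
  <= N.+1%:R^-1 * (step_error k * L (weight k.+1)).
Proof.
move=> etaN; rewrite -step_value -functionalZ; last exact: poly_bounded_weight.
have wb : poly_bounded (fun x => step_error k * weight k.+1 x).
  have := poly_bounded_lin (step_error k) (poly_bounded_weight k.+1) poly_bounded0.
  by under eq_fun do rewrite addr0.
rewrite -functionalZ //; apply: functional_dist_le.
- exact: (functional_sum _ _ (fun j => @poly_bounded_indic _)).1.
- exact: poly_bounded_expr.
- have := poly_bounded_lin N.+1%:R^-1 wb poly_bounded0.
  by under eq_fun do rewrite addr0.
- by move=> x; exact: step_approx.
Qed.

(** L need not be countably additive on indicators, but the right limits of its
    distribution function give a measure m. Step functions turn the comparison
    of m with L on a monomial into a pointwise estimate by a small multiple of a
    weight, on which L is finite. Integrability of the monomials follows from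
    the same estimate and Fatou's lemma, applied to even powers. *)
Theorem functional_measure : exists m : {finite_measure set T -> \bar R},
  (forall x, L \1_(`]-oo, y]%classic) @[y --> x^'+] --> fine (m `]-oo, x]%classic))
  /\ forall k, m.-integrable setT (EFin \o (fun x : T => x ^+ k : R)) /\
       Rintegral m setT (fun x : T => x ^+ k) = L (fun x => x ^+ k).
Proof.
have [m mlim] := right_limit_measure F_homo F_bound F_inf.
exists m; split=> //.
have mcell N j : fine (m `]grid N j, grid N j.+1]%classic)
    = fine (m `]-oo, grid N j.+1]%classic) - fine (m `]-oo, grid N j]%classic).
  by apply: fine_measure_oc; apply: grid_homo.
have sum_dist N k :
    `|\sum_(j < 2 * N.+1 ^ 2) grid N j ^+ k *
        fine (m `]grid N j, grid N j.+1]%classic) - L (fun x => x ^+ k)|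
    <= N.+1%:R^-1 * (step_error k * L (weight k.+1)).
  (* Every eta i is at most 1 / (N + 1), as step_value_dist requires. *)
  pose eta (i : nat) : R := (i + N.+1)%:R^-1.
  have eta0 i : 0 < eta i by rewrite invr_gt0 ltr0n addnS.
  have etalim : eta i @[i --> \oo] --> (0 : R).
    apply/cvgrPdist_lt => e e0; have /cvgrPdist_lt /(_ e e0) := @cvg_harmonic R.
    apply: filterS => i; rewrite !sub0r !normrN.
    apply: le_lt_trans; rewrite !ger0_norm ?harmonic_ge0 //; last exact: ltW.
    by rewrite lef_pV2 ?posrE ?ltr0n ?addnS // ler_nat ltnS leq_addr.
  have Flim x : F (x + eta i) @[i --> \oo] --> fine (m `]-oo, x]%classic).
    have /cvg_at_rightP H := mlim x.
    apply: H; split; first by move=> i; rewrite ltrDl.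
    by rewrite -[X in _ --> X]addr0; apply: cvgD => //; exact: cvg_cst.
  pose S i := `|\sum_(j < 2 * N.+1 ^ 2) grid N j ^+ k *
      (F (grid N j.+1 + eta i) - F (grid N j + eta i)) - L (fun x => x ^+ k)|.
  have Slim : S i @[i --> \oo] --> `|\sum_(j < 2 * N.+1 ^ 2) grid N j ^+ k *
        fine (m `]grid N j, grid N j.+1]%classic) - L (fun x => x ^+ k)|.
    apply: cvg_norm; apply: cvgB; last exact: cvg_cst.
    apply: cvg_sumr => j; apply: cvgMl_tmp; rewrite mcell.
    by apply: cvgB; exact: Flim.
  rewrite -(cvg_lim _ Slim) //; apply: limr_le; first by apply/cvg_ex; eexists; exact: Slim.
  apply: nearW => i; apply: step_value_dist; rewrite ltW //=.
  by rewrite lef_pV2 ?posrE ?ltr0n ?addnS // ler_nat ltnS leq_addl.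
have even_int k : m.-integrable setT (EFin \o (fun x : T => x ^+ (2 * k) : R)).
  pose g N (x : T) : R := \sum_(j < 2 * N.+1 ^ 2) grid N j ^+ (2 * k) *
      \1_(`]grid N j, grid N j.+1]%classic) x.
  have gint N : m.-integrable setT (EFin \o g N) :=
    (step_integral m (grid N) (fun j => grid N j ^+ (2 * k)) (2 * N.+1 ^ 2)).1.
  have mg N : measurable_fun setT (EFin \o g N) by case/integrableP: (gint N).
  have g0 N x : 0 <= g N x.
    by apply: sumr_ge0 => j _; rewrite mulr_ge0 // exprM exprn_ge0 ?sqr_ge0.
  have glim x : g N x @[N --> \oo] --> x ^+ (2 * k).
    apply/cvgrPdist_lt => e e0.
    set c := step_error (2 * k) * weight (2 * k).+1 x.
    have /cvgrPdist_lt /(_ e e0) : (N.+1%:R^-1 * c) @[N --> \oo] --> (0 : R).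
      rewrite -(mul0r c); apply: cvgMr_tmp; exact: cvg_harmonic.
    apply: filterS => N; rewrite sub0r normrN => /(le_lt_trans (ler_norm _)).
    apply: le_lt_trans; rewrite distrC /g.
    have := @step_approx R N (2 * k) 0 x; rewrite lexx invr_ge0 ler0n => /(_ isT).
    by under eq_bigr do rewrite !addr0.
  pose C := L (fun x => x ^+ (2 * k))
            + `|step_error (2 * k) * L (weight (2 * k).+1)|.
  have gbound N : (\int[m]_x (EFin \o g N) x <= C%:E)%E.
    rewrite -(fineK (integrable_fin_num measurableT (gint N))).
    rewrite lee_fin -[fine _]/(Rintegral m setT (g N)).
    rewrite /g (step_integral m (grid N) (fun j => grid N j ^+ (2 * k)) _).2.
    have := sum_dist N (2 * k); rewrite ler_distl => /andP[_] /le_trans; apply.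
    rewrite lerD2l (le_trans (ler_norm _)) // normrM ler_piMl //.
    by rewrite ger0_norm ?invr_ge0 // invf_le1 ?ltr0Sn // ler1n.
  apply/integrableP; split.
    by apply/measurable_EFinP; exact: measurable_expr.
  apply: (@le_lt_trans _ _ C%:E); last exact: ltry.
  rewrite (_ : (fun x => _) = (fun x : T => limn_einf (fun N => (EFin \o g N) x))).
    apply: (le_trans (fatou m measurableT mg _)).
      by move=> N x _; rewrite lee_fin.
    rewrite limn_einf_lim; apply: lime_le; first exact: is_cvg_einfs.
    apply: nearW => N; apply: le_trans (gbound N).
    by apply: ereal_inf_lbound; exists N => //=.
  apply/funext => x /=; rewrite ger0_norm; last by rewrite exprM exprn_ge0 ?sqr_ge0.
  apply/esym; apply: (cvg_limn_einf_sup _).1; apply/cvg_EFin; last exact: glim.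
  by apply: nearW => N.
have all_int k : m.-integrable setT (EFin \o (fun x : T => x ^+ k : R)).
  have wi : m.-integrable setT (EFin \o (weight k : T -> R)).
    have := integrableD measurableT (even_int 0%N) (even_int k).
    by apply: eq_integrable => // x _ /=; rewrite expr0.
  apply: le_integrable wi => //.
    by apply/measurable_EFinP; exact: measurable_expr.
  move=> x _ /=; rewrite lee_fin [leRHS]ger0_norm; last by rewrite ltW // weight_gt0.
  rewrite normrX /weight mulnC exprM -(real_normK (num_real (x ^+ k))) normrX.
  have := sqr_ge0 (`|x| ^+ k - 1); have := sqr_ge0 (`|x| ^+ k).
  by nra.
move=> k; split=> //; apply/eqP; rewrite -subr_eq0 -normr_le0.
set c := step_error k * Rintegral m setT (weight k.+1 : T -> R)
         + step_error k * L (weight k.+1).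
have : (N.+1%:R^-1 * c) @[N --> \oo] --> (0 : R).
  rewrite -(mul0r c); apply: cvgMr_tmp; exact: cvg_harmonic.
move=> clim; rewrite -(cvg_lim _ clim) //; apply: limr_ge.
  by apply/cvg_ex; eexists; exact: clim.
apply: nearW => N; have := riemann_sum_dist all_int k N; have := sum_dist N k.
rewrite /c mulrDr; set a := \sum_(_ < _) _ => H1 H2.
have := ler_normD (Rintegral m setT (fun x : T => x ^+ k) - a) (a - L (fun x => x ^+ k)).
rewrite addrA subrK => /le_trans; apply.
by rewrite (distrC _ a) lerD.
Qed.

End Functional.
End PositiveFunctional.

(** * Quadratic forms and polarization *)

Local Open Scope complex_scope.

Section Polarization.
Context {R : realType}.
Local Notation C := R[i].
Implicit Types (c v : 'I_2 -> C) (e : ('I_2 -> C) -> R) (z : C).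

Lemma Re_sum (I : Type) (r : seq I) (P : pred I) (F : I -> C) :
  complex.Re (\sum_(i <- r | P i) F i) = \sum_(i <- r | P i) complex.Re (F i).
Proof. by apply: (big_morph (fun z => complex.Re z)) => // -[a b] [c d]. Qed.

Lemma Im_sum (I : Type) (r : seq I) (P : pred I) (F : I -> C) :
  complex.Im (\sum_(i <- r | P i) F i) = \sum_(i <- r | P i) complex.Im (F i).
Proof. by apply: (big_morph (fun z => complex.Im z)) => // -[a b] [c d]. Qed.

Lemma Re_mulc z z' : complex.Re (z * z') =
  complex.Re z * complex.Re z' - complex.Im z * complex.Im z'.
Proof. by case: z z' => a b [c d]. Qed.

Lemma Im_mulc z z' : complex.Im (z * z') =
  complex.Re z * complex.Im z' + complex.Im z * complex.Re z'.
Proof. by case: z z' => a b [c d]. Qed.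

(** Complex integrals are defined by their real and imaginary parts, and so is
    their convergence. *)
Definition ccvg (U : Type) (F : set_system U) (f : U -> C) z :=
  (complex.Re (f u) @[u --> F] --> complex.Re z) /\
  (complex.Im (f u) @[u --> F] --> complex.Im z).

Section ComplexConvergence.
Context (U : Type) (F : set_system U) {FF : ProperFilter F}.
Implicit Types f : U -> C.

Lemma ccvg_real (g : U -> R) (a : R) : g u @[u --> F] --> a ->
  ccvg F (fun u => (g u)%:C) a%:C.
Proof. by move=> ga; split => //=; exact: cvg_cst. Qed.

Lemma ccvgZ f z z' : ccvg F f z -> ccvg F (fun u => z' * f u) (z' * z).
Proof.
move=> [Ref Imf]; split.
  rewrite Re_mulc (funext (fun u => Re_mulc z' (f u))).
  by apply: cvgB; apply: cvgMl_tmp.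
rewrite Im_mulc (funext (fun u => Im_mulc z' (f u))).
by apply: cvgD; apply: cvgMl_tmp.
Qed.

Lemma ccvg_sum (I : Type) (r : seq I) (f : I -> U -> C) (l : I -> C) :
  (forall i, ccvg F (f i) (l i)) ->
  ccvg F (fun u => \sum_(i <- r) f i u) (\sum_(i <- r) l i).
Proof.
move=> fl; split.
  rewrite Re_sum (funext (fun u => Re_sum r xpredT (f^~ u))).
  by apply: cvg_sumr => i; case: (fl i).
rewrite Im_sum (funext (fun u => Im_sum r xpredT (f^~ u))).
by apply: cvg_sumr => i; case: (fl i).
Qed.

Lemma ccvg_unique f z z' : ccvg F f z -> ccvg F f z' -> z = z'.
Proof.
case: z z' => a b [a' b'] [/= Rez Imz] [/= Rez' Imz'].
by congr (_ +i* _); [apply: cvg_unique Rez Rez'|apply: cvg_unique Imz Imz'].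
Qed.

Lemma ccvg_ge0 f z : (forall u, 0 <= f u) -> ccvg F f z -> 0 <= z.
Proof.
case: z => a b f0 [/= Ref Imf].
have b0 : b = 0.
  apply: cvg_unique Imf _ => //.
  rewrite (_ : (fun u => _) = cst 0); first exact: cvg_cst.
  by apply/funext => u; rewrite ger0_Im.
rewrite b0 lecE /= eqxx -(cvg_lim _ Ref) //.
apply: limr_ge; first by apply/cvg_ex; eexists; exact: Ref.
by apply: nearW => u; have := f0 u; rewrite lecE => /andP[].
Qed.

End ComplexConvergence.

Definition sqmod z : R := complex.Re z ^+ 2 + complex.Im z ^+ 2.

Lemma sqmod_ge0 z : 0 <= sqmod z.
Proof. by rewrite addr_ge0 ?sqr_ge0. Qed.

Lemma sqmodE z : (sqmod z)%:C = z * z^*.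
Proof.
case: z => a b; apply/eqP; rewrite eq_complex /sqmod /=.
by apply/andP; split; apply/eqP; ring.
Qed.

(** The polarization identity is used at half of e_i + w e_j for the fourth roots
    of unity w, so that polar needs no division. *)
Definition direction (w : C) (i j l : 'I_2) : C := ((l == i)%:R + w * (l == j)%:R) / 2.

Definition polar e (i j : 'I_2) : C :=
  (e (direction 1 i j) - e (direction (-1) i j)) +i*
  (e (direction 'i i j) - e (direction (- 'i) i j)).

Lemma polar_lim (U : Type) (F : set_system U) {FF : ProperFilter F}
    (E : U -> ('I_2 -> C) -> R) e i j : (forall c, E u c @[u --> F] --> e c) ->
  ccvg F (fun u => polar (E u) i j) (polar e i j).
Proof. by move=> Elim; split; apply: cvgB; exact: Elim. Qed.

(** For fixed c the condition is linear in e and survives pointwise limits, which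
    carries it from the weights of single atoms to the limit measures. *)
Definition quadratic_form e :=
  forall c, (e c)%:C = \sum_(i < 2) \sum_(j < 2) c i * (c j)^* * polar e i j.

Lemma direction_dot w i j v :
  \sum_l direction w i j l * v l = (v i + w * v j) / 2.
Proof.
have pick (k : 'I_2) : \sum_l ((l == k)%:R : C) * v l = v k.
  rewrite (bigD1 k) //= eqxx mul1r big1 ?addr0 // => l /negbTE ->.
  by rewrite mul0r.
under eq_bigr do rewrite /direction mulrAC mulrDl -mulrA.
by rewrite -mulr_suml big_split /= -mulr_sumr !pick.
Qed.

Lemma polar_sqmod v (i j : 'I_2) :
  polar (fun c => sqmod (\sum_l c l * v l)) i j = v i * (v j)^*.
Proof.
rewrite /polar !direction_dot; case: (v i) => a b; case: (v j) => p q.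
have half : (2^-1 : C) = (2^-1 : R)%:C by rewrite fmorphV /= rmorph_nat.
rewrite half; apply/eqP; rewrite eq_complex /sqmod /=; apply/andP; split; apply/eqP; by field.
Qed.

Lemma quadratic_form_sqmod v : quadratic_form (fun c => sqmod (\sum_l c l * v l)).
Proof.
move=> c; rewrite sqmodE rmorph_sum mulr_suml; apply: eq_bigr => i _.
rewrite mulr_sumr; apply: eq_bigr => j _; rewrite polar_sqmod rmorphM /=; ring.
Qed.

Lemma polar_lin (a : R) e e' i j :
  polar (fun c => a * e c + e' c) i j = a%:C * polar e i j + polar e' i j.
Proof.
by apply/eqP; rewrite eq_complex /=; apply/andP; split; apply/eqP; ring.
Qed.

Lemma quadratic_form_lin (a : R) e e' : quadratic_form e -> quadratic_form e' ->
  quadratic_form (fun c => a * e c + e' c).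
Proof.
move=> qe qe' c; rewrite rmorphD rmorphM /= qe qe' mulr_sumr -big_split /=.
apply: eq_bigr => i _; rewrite mulr_sumr -big_split /=; apply: eq_bigr => j _.
rewrite polar_lin; ring.
Qed.

Lemma quadratic_form0 : quadratic_form (fun=> 0).
Proof.
move=> c; rewrite big1 // => i _; rewrite big1 // => j _.
by rewrite /polar subrr mulr0.
Qed.

Lemma quadratic_form_sum (I : Type) (r : seq I) (a : I -> R)
    (E : I -> ('I_2 -> C) -> R) : (forall i, quadratic_form (E i)) ->
  quadratic_form (fun c => \sum_(i <- r) a i * E i c).
Proof.
move=> qE; elim: r => [|i r IHr].
  rewrite (_ : (fun c => _) = (fun=> 0)); first exact: quadratic_form0.
  by apply/funext => c; rewrite big_nil.
rewrite (_ : (fun c => _) = (fun c => a i * E i c + \sum_(k <- r) a k * E k c)).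
  exact: quadratic_form_lin.
by apply/funext => c; rewrite big_cons.
Qed.

Lemma polar_sum (I : Type) (r : seq I) (a : I -> R)
    (E : I -> ('I_2 -> C) -> R) i j :
  polar (fun c => \sum_(k <- r) a k * E k c) i j
  = \sum_(k <- r) (a k)%:C * polar (E k) i j.
Proof.
elim: r => [|k r IHr].
  by rewrite /polar !big_nil subrr.
rewrite big_cons -IHr -polar_lin; congr (polar _ i j).
by apply/funext => c; rewrite big_cons.
Qed.

Lemma quadratic_form_lim (U : Type) (F : set_system U) {FF : ProperFilter F}
    (E : U -> ('I_2 -> C) -> R) e :
  (forall u, quadratic_form (E u)) -> (forall c, E u c @[u --> F] --> e c) ->
  quadratic_form e.
Proof.
move=> qE Elim c; apply: (ccvg_unique (ccvg_real (Elim c))).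
rewrite (funext (fun u => qE u c)).
apply: ccvg_sum => i; apply: ccvg_sum => j; apply: ccvgZ; exact: polar_lim.
Qed.

End Polarization.

(** * Ultralimits of atomic matrix measures *)

Section UltraLimit.
Context {R : realType}.

(** An ultrafilter converges along any map to its cluster points. *)
Lemma ultra_bounded_cvg (U : set_system nat) (u : nat -> R) (B : R) :
  UltraFilter U -> (\forall n \near U, `|u n| <= B) -> cvg (u n @[n --> U]).
Proof.
move=> UU uB.
have [|p [_ clp]] := @segment_compact R (- B) B (u n @[n --> U]) _.
  by apply: filterS uB => n /=; rewrite in_itv /= ler_norml.
apply/cvg_ex; exists p => A pA.
have [//|nA] := in_ultra_setVsetC (u @^-1` A) UU.
have [y [/= nAy Ay]] := clp (~` A) A nA pA.
by [].
Qed.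

End UltraLimit.

Section MatrixLimit.
Context {R : realType}.
Local Notation C := R[i].
Variables (S : nat -> 'I_2 -> 'I_2 -> C) (x : nat -> nat -> R).
Variable v : nat -> nat -> 'I_2 -> C.

(** There are n + 2 atoms at level n, one for each index below n + 2, so that the
    indices 0 and 1 of the two constant vectors occur at every level. *)
Definition atomic_moment n k i j : C :=
  \sum_(r < n.+2) (x n r ^+ k)%:C * (v n r i * (v n r j)^*).

Hypothesis atomic_moment_lim : forall k i j,
  ccvg \oo (fun n => atomic_moment n k i j) (S k i j).

Definition atomic_functional n (c : 'I_2 -> C) (f : R -> R) : R :=
  \sum_(r < n.+2) f (x n r) * sqmod (\sum_l c l * v n r l).

Lemma quadratic_atomic n f : quadratic_form (fun c => atomic_functional n c f).
Proof. by apply: quadratic_form_sum => r; exact: quadratic_form_sqmod. Qed.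

Lemma polar_atomic n k i j :
  polar (fun c => atomic_functional n c (fun y => y ^+ k)) i j
  = atomic_moment n k i j.
Proof.
by rewrite polar_sum; apply: eq_bigr => r _; rewrite polar_sqmod.
Qed.

Lemma atomic_functional_expr_cvg c k :
  cvg (atomic_functional n c (fun y => y ^+ k) @[n --> \oo]).
Proof.
have E n : (atomic_functional n c (fun y => y ^+ k))%:C =
    \sum_(i < 2) \sum_(j < 2) c i * (c j)^* * atomic_moment n k i j.
  rewrite quadratic_atomic; apply: eq_bigr => i _; apply: eq_bigr => j _.
  by rewrite polar_atomic.
have [Elim _] : ccvg \oo (fun n => (atomic_functional n c (fun y => y ^+ k))%:C)
    (\sum_(i < 2) \sum_(j < 2) c i * (c j)^* * S k i j).
  rewrite (funext E); apply: ccvg_sum => i; apply: ccvg_sum => j.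
  exact: ccvgZ.
by apply/cvg_ex; eexists; exact: Elim.
Qed.

Lemma atomic_functional_lin n c a f g :
  atomic_functional n c (fun y => a * f y + g y)
  = a * atomic_functional n c f + atomic_functional n c g.
Proof.
rewrite /atomic_functional mulr_sumr -big_split /=; apply: eq_bigr => r _.
by rewrite mulrDl mulrA.
Qed.

Lemma atomic_functional_le n c f g : (forall y, f y <= g y) ->
  atomic_functional n c f <= atomic_functional n c g.
Proof. by move=> fg; apply: ler_sum => r _; rewrite ler_wpM2r // sqmod_ge0. Qed.

Lemma atomic_functional_bounded c f : poly_bounded f ->
  exists B, \forall n \near \oo, `|atomic_functional n c f| <= B.
Proof.
move=> [a [k fa]].
have wlim : cvg (atomic_functional n c (fun y => a * weight k y) @[n --> \oo]).
  have E n : atomic_functional n c (fun y => a * weight k y) =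
      a * atomic_functional n c (fun y => y ^+ 0)
      + a * atomic_functional n c (fun y => y ^+ (2 * k)).
    rewrite -mulrDr /atomic_functional -big_split /= mulr_sumr.
    by apply: eq_bigr => r _; rewrite /weight expr0 -mulrDl mulrA.
  rewrite (funext E); apply: is_cvgD; apply: is_cvgMl_tmp; exact: atomic_functional_expr_cvg.
have [B [_ HB]] := cvg_seq_bounded wlim.
exists (B + 1); apply: nearW => n.
apply: le_trans (HB (B + 1) _ n I); last by rewrite ltrDl.
apply: (@le_trans _ _ (atomic_functional n c (fun y => a * weight k y))).
  rewrite ler_norml; apply/andP; split; last first.
    by apply: atomic_functional_le => y; exact: le_trans (ler_norm _) (fa y).
  rewrite -sumrN; apply: ler_sum => r _; rewrite -mulNr ler_wpM2r ?sqmod_ge0 //.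
  by have := fa (x n r); rewrite ler_norml => /andP[].
exact: ler_norm.
Qed.

Section Ultra.
Variable U : set_system nat.
Hypothesis UU : UltraFilter U.
Hypothesis Uoo : \oo `<=` U.

Let PU : ProperFilter U := ultra_proper.
Local Existing Instance PU.

(** A single ultrafilter serves all c and all f at once, so that the limit is
    linear in f and quadratic in c. *)
Definition limit_functional c f : R := lim (atomic_functional n c f @[n --> U]).

Lemma limit_functional_cvg c f : poly_bounded f ->
  atomic_functional n c f @[n --> U] --> limit_functional c f.
Proof.
move=> /(atomic_functional_bounded c)[B fB].
exact: (ultra_bounded_cvg UU (Uoo fB)).
Qed.

Lemma limit_functional_positive c : positive_functional (limit_functional c).
Proof.
split=> [a f g fb gb|f fb f0].
  apply: cvg_lim => //.
  rewrite (funext (fun n => atomic_functional_lin n c a f g)).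
  by apply: cvgD; [apply: cvgMl_tmp|]; exact: limit_functional_cvg.
apply: limr_ge; first by apply/cvg_ex; eexists; exact: limit_functional_cvg fb.
by apply: nearW => n; apply: sumr_ge0 => r _; rewrite mulr_ge0 // sqmod_ge0.
Qed.

Lemma limit_functional_quadratic f : poly_bounded f ->
  quadratic_form (fun c => limit_functional c f).
Proof.
move=> fb; apply: (quadratic_form_lim (F := U)
  (E := fun n c => atomic_functional n c f)).
  by move=> n; exact: quadratic_atomic.
by move=> c; exact: limit_functional_cvg.
Qed.

Lemma limit_functional_polar k i j :
  polar (fun c => limit_functional c (fun y => y ^+ k)) i j = S k i j.
Proof.
have Llim c := @limit_functional_cvg c _ (poly_bounded_expr k).
apply: (ccvg_unique (polar_lim i j Llim)).
rewrite (funext (fun n => polar_atomic n k i j)).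
by have [ReS ImS] := atomic_moment_lim k i j; split=> A; [move/ReS/Uoo|move/ImS/Uoo].
Qed.

End Ultra.
End MatrixLimit.

(** * Matrices of measures depending quadratically on a vector *)

Section FiniteMeasures.
Context d (T : measurableType d) {R : realType}.
Implicit Types m : {finite_measure set T -> \bar R}.

Lemma fine_measure_series m (F : (set T) ^nat) : (forall i, measurable (F i)) ->
  trivIset setT F ->
  \sum_(0 <= i < n) fine (m (F i)) @[n --> \oo] --> fine (m (\bigcup_n F n)).
Proof.
move=> mF tF; have mU : measurable (\bigcup_n F n) by exact: bigcup_measurable.
have /fine_cvgP[_] : (\sum_(0 <= i < n) m (F i))%E @[n --> \oo]
    --> (fine (m (\bigcup_n F n)))%:E.
  by rewrite fineK ?fin_num_measure //; exact: measure_semi_sigma_additive.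
apply: cvg_trans; apply: near_eq_cvg; apply: nearW => n /=.
rewrite -sum_fine // => i _; exact: fin_num_measure.
Qed.

Lemma difference_sigma_additive m1 m2 :
  semi_sigma_additive (fun A => (fine (m1 A) - fine (m2 A))%:E).
Proof.
move=> F mF tF _; apply/fine_cvgP; split.
  by apply: nearW => n; rewrite sumEFin.
rewrite (_ : fine \o _ = (fun n => \sum_(0 <= i < n) fine (m1 (F i))
                                 - \sum_(0 <= i < n) fine (m2 (F i)))).
  by apply: cvgB; exact: fine_measure_series.
by apply/funext => n /=; rewrite sumEFin /= sumrB.
Qed.

Let difference0 (m1 m2 m3 m4 : {finite_measure set T -> \bar R}) :
  (fine (m1 set0) - fine (m2 set0)) +i* (fine (m3 set0) - fine (m4 set0)) = 0.
Proof. by rewrite !measure0 subrr. Qed.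

Definition difference_measure (m1 m2 m3 m4 : {finite_measure set T -> \bar R}) :
    complex_measure T R :=
  ComplexMeasure
    (cmeasure := fun A => (fine (m1 A) - fine (m2 A)) +i* (fine (m3 A) - fine (m4 A)))
    (difference0 m1 m2 m3 m4)
    (@difference_sigma_additive m1 m2) (@difference_sigma_additive m3 m4).

Lemma difference_measure_integral (m1 m2 m3 m4 : {finite_measure set T -> \bar R})
    (f : T -> R) :
  m1.-integrable setT (EFin \o f) -> m2.-integrable setT (EFin \o f) ->
  m3.-integrable setT (EFin \o f) -> m4.-integrable setT (EFin \o f) ->
  cintegrable (difference_measure m1 m2 m3 m4) f /\
  cintegral (difference_measure m1 m2 m3 m4) f =
  (Rintegral m1 setT f - Rintegral m2 setT f) +i*
  (Rintegral m3 setT f - Rintegral m4 setT f).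
Proof.
move=> f1 f2 f3 f4.
have subE m m' (A : set T) : measurable A ->
    (fine (m A) - fine (m' A))%:E = (m A - m' A)%E.
  by move=> mA; rewrite EFinB !fineK // fin_num_measure.
have [Rei ReE] := charge_integral_sub
  (nu := Re_measure (difference_measure m1 m2 m3 m4)) (subE m1 m2) f1 f2.
have [Imi ImE] := charge_integral_sub
  (nu := Im_measure (difference_measure m1 m2 m3 m4)) (subE m3 m4) f3 f4.
by split; [split|rewrite /cintegral ReE ImE].
Qed.

End FiniteMeasures.

Section QuadraticMeasure.
Context {R : realType}.
Local Notation C := R[i].
Local Notation T := (measurableTypeR R).

(** The sets A with this property form a lambda-system, and it contains the
    half-open intervals, which are differences of half-lines. *)
Lemma quadratic_form_measure (m : ('I_2 -> C) -> {finite_measure set T -> \bar R}) :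
  (forall x, quadratic_form (fun c => fine (m c `]-oo, x]%classic))) ->
  forall A, measurable A -> quadratic_form (fun c => fine (m c A)).
Proof.
move=> qm.
have setTE : [set: T] = \bigcup_n `]-oo, n%:R]%classic.
  apply/seteqP; split=> // y _; exists (Num.bound `|y|) => //=.
  by rewrite in_itv /= (le_trans (ler_norm _)) // ltW // archi_boundP.
have mA (i : interval R) : measurable ([set` i] : set T) by exact: measurable_itv.
have qT : quadratic_form (fun c => fine (m c setT)).
  apply: (quadratic_form_lim (F := \oo) (E := fun n c => fine (m c `]-oo, n%:R]%classic))).
    by move=> n; exact: qm.
  move=> c; rewrite setTE.
  have H : (m c \o (fun n => `]-oo, n%:R]%classic)) n @[n --> \oo]
      --> m c (\bigcup_n `]-oo, n%:R]%classic).
    apply: nondecreasing_cvg_mu => //; first exact: bigcup_measurable.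
    move=> n n' nn'; apply/subsetPset => y /=; rewrite !in_itv /= => /le_trans.
    by apply; rewrite ler_nat.
  rewrite -setTE in H *; move: H.
  by rewrite -(fineK (fin_num_measure (m c) _ measurableT)) => /fine_cvgP[].
move=> A mAA.
apply: (@dynkin_induction _ T (@ocitv R)
  (fun A => quadratic_form (fun c => fine (m c A)))) => //.
- exact: ocitvI.
- move=> X /ocitvP[->|[[a b] /= ab ->]].
    rewrite (_ : (fun c => _) = (fun=> 0)); first exact: quadratic_form0.
    by apply/funext => c; rewrite measure0.
  have := quadratic_form_lin (-1) (qm a) (qm b).
  congr quadratic_form; apply/funext => c.
  by rewrite mulN1r addrC fine_measure_oc // ltW.
- move=> X mX qX; have := quadratic_form_lin (-1) qX qT.
  congr quadratic_form; apply/funext => c; rewrite mulN1r addrC -setTD.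
  rewrite measureD ?setTI // ?fineB ?fin_num_measure //.
  by rewrite ltey_eq fin_num_measure.
- move=> F mF tF qF.
  apply: (quadratic_form_lim (F := \oo)
    (E := fun n c => \sum_(0 <= i < n) fine (m c (F i)))).
    move=> n; have := quadratic_form_sum (index_iota 0 n) (fun=> 1) qF.
    by congr quadratic_form; apply/funext => c; apply: eq_bigr => i _; rewrite mul1r.
  by move=> c; exact: fine_measure_series.
Qed.

End QuadraticMeasure.

(** * The matrix moment problem *)

Section FormKernel.
Context {R : realType}.
Local Notation C := R[i].
Variable t : nat -> nat -> 'rV[C]_2 -> 'rV[C]_2 -> C.
Hypotheses (t_form : is_form t) (t_inv : translation_invariant t).
Hypothesis t_psd : form_posdef t.

Lemma form_scale m n z w (a b : 'rV[C]_2) :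
  t m n (z *: a) (w *: b) = z * (w^* * t m n a b).
Proof.
have [tl tr] := t_form m n.
have tl0 c : t m n 0 c = 0.
  have := tl c (-1) 0 0; rewrite scaler0 addr0 /= => ->.
  by rewrite mulN1r addNr.
have tr0 c : t m n c 0 = 0.
  have := tr c (-1) 0 0; rewrite scaler0 addr0 /= => ->.
  by rewrite rmorphN rmorph1 mulN1r addNr.
have := tl (w *: b) z a 0; rewrite addr0 tl0 addr0 => ->.
by have := tr a w b 0; rewrite addr0 tr0 addr0 => ->.
Qed.

Lemma form_translate m n (a b : 'rV[C]_2) : t m n a b = t (m + n) 0 a b.
Proof. by rewrite t_inv. Qed.

(** A sesquilinear form with real values on the diagonal is Hermitian. *)
Lemma form_hermitian m n (a b : 'rV[C]_2) : t n m b a = (t m n a b)^*.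
Proof.
have real1 k c : complex.Im (t k k c c) = 0.
  have := t_psd (fun _ : 'I_1 => k) (fun _ => c).
  by rewrite !big_ord1 => /ger0_Im.
have real2 c : complex.Im (t m n a c + t n m c a) = 0.
  have := t_psd (fun k : 'I_2 => if k == 0 then m else n)
                (fun k : 'I_2 => if k == 0 then a else c).
  rewrite !big_ord_recl !big_ord0 /= !addr0 => /ger0_Im.
  move: (real1 m a) (real1 n c).
  case: (t m m a a) (t n n c c) (t m n a c) (t n m c a) => [a1 b1] [a2 b2] [a3 b3] [a4 b4] /=.
  by move=> -> ->; rewrite add0r addr0.
have := real2 b; have := real2 ('i *: b).
rewrite -{1}[a]scale1r form_scale -{2}[a]scale1r form_scale.
case: (t m n a b) (t n m b a) => [a1 b1] [a2 b2] /= H1 H2.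
apply/eqP; rewrite eq_complex /=; apply/andP; split; apply/eqP; lra.
Qed.

(** The index p stands for the monomial of degree p / 2 times the basis vector of
    index p mod 2, so that multiplication by the variable is the shift by 2. *)
Definition component (p : nat) : 'rV[C]_2 := delta_mx 0 (inord (odd p)).

Definition form_kernel (p q : nat) : C := t p./2 q./2 (component p) (component q).

Lemma form_approx_atoms n : exists xv : (nat -> R) * (nat -> 'I_2 -> C),
  forall k (i j : 'I_2), (i + 2 * k < n.+2)%N ->
    `|\sum_(r < n.+2) (xv.1 r ^+ k)%:C * (xv.2 r i * (xv.2 r j)^*)
      - t k 0 (delta_mx 0 i) (delta_mx 0 j)| <= n.+3%:R^-1.
Proof.
have [p q|p q|N u|x [V [xreal VE]]] := @approx_atoms _ 2 form_kernel _ _ _ n.+2.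
- exact: form_hermitian.
- by rewrite /form_kernel /component !addn2 /= !negbK -addn1 t_inv addn1.
- have := t_psd (fun p : 'I_N => p./2) (fun p : 'I_N => u 0 p *: component p).
  congr (0 <= _); apply: eq_bigr => p _; apply: eq_bigr => q _.
  by rewrite form_scale mulrA.
exists (fun r => complex.Re (x (inord r)),
        fun r i => V (widen_ord (isT : (2 <= n.+2)%N) i) (inord r)) => k i j ikn /=.
have := VE k (widen_ord (isT : (2 <= n.+2)%N) i) (Ordinal ikn)
  (widen_ord (isT : (2 <= n.+2)%N) j) erefl.
congr (`|_ - _| <= _).
  apply: eq_bigr => r _; rewrite inord_val rmorphXn /=.
  by rewrite RRe_real.
have half (l : 'I_2) s : (l + 2 * s)./2 = s.
  by rewrite mul2n halfD odd_double andbF add0n doubleK; case: l => -[|[]].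
have oddE (l : 'I_2) s : inord (odd (l + 2 * s)) = l.
  apply: val_inj; rewrite /= inordK ?ltnS ?leq_b1 // mul2n oddD odd_double addbF.
  by case: l => -[|[]].
rewrite /form_kernel /component /= half oddE.
by have := half j 0%N; have := oddE j 0%N; rewrite muln0 addn0 => -> ->.
Qed.

End FormKernel.

Section MatrixHamburger.
Context {R : realType}.
Local Notation C := R[i].
Local Notation T := (measurableTypeR R).

(** The Hamburger moment problem for 2 x 2 matrices. At level n the atoms carry
    the rank one weights v_i conj(v_j), and |sum_i c_i v_i|^2 is a nonnegative
    scalar weight for every c. The ultralimits of these scalar measures are represented
    by measures m c that depend on c as a quadratic form; polarizing them gives
    the entries mu i j, and positivity of the matrix is positivity of m c. *)
Theorem form_representing_matrix (t : nat -> nat -> 'rV[C]_2 -> 'rV[C]_2 -> C) :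
  is_form t -> translation_invariant t -> form_posdef t ->
  exists mu : 'I_2 -> 'I_2 -> complex_measure T R, matrix_measure_posdef mu /\
    forall k i j, cintegrable (mu i j) (fun y : R => y ^+ k) /\
      cintegral (mu i j) (fun y : R => y ^+ k) = t k 0 (delta_mx 0 i) (delta_mx 0 j).
Proof.
move=> t_form t_inv t_psd.
have [xv xvE] := choice (form_approx_atoms t_form t_inv t_psd).
pose x n := (xv n).1; pose v n := (xv n).2.
pose S k i j := t k 0 (delta_mx 0 i) (delta_mx 0 j).
have Slim k i j : ccvg \oo (fun n => atomic_moment x v n k i j) (S k i j).
  have near_bound (P : C -> R) : (forall z w, P (z - w) = P z - P w) ->
      (forall z, (`|P z|)%:C <= `|z|) ->
      P (atomic_moment x v n k i j) @[n --> \oo] --> P (S k i j).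
    move=> Psub Ple; apply/cvgrPdist_lt => e e0.
    have /cvgrPdist_lt /(_ e e0) := @cvg_harmonic R.
    apply: filter_app; near=> n.
    rewrite sub0r normrN ger0_norm ?harmonic_ge0 //; apply: le_lt_trans.
    rewrite distrC -Psub -lecR; apply: (le_trans (Ple _)).
    apply: (le_trans (xvE n k i j _)).
      by near: n; exists (i + 2 * k)%N => // n /= /leq_ltn_trans; apply; rewrite ltnS leqW.
    rewrite /harmonic rmorphV ?unitfE ?pnatr_eq0 // rmorph_nat.
    by rewrite lef_pV2 ?posrE ?ltr0n // ler_nat ltnS leqW.
  split; apply: near_bound.
  - by move=> [? ?] [? ?].
  - exact: normc_ge_Re.
  - by move=> [? ?] [? ?].
  - move=> z; have := normc_ge_Re (z * 'i); rewrite ReiNIm normrN normrM.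
    by rewrite [`|'i|]normc_def /= expr0n expr1n add0r sqrtr1 mulr1.
have [U [UU Uoo]] := @ultraFilterLemma nat \oo _.
pose L := limit_functional x v U.
have Lpos := limit_functional_positive Slim UU Uoo.
have [m mE] := choice (fun c => functional_measure (Lpos c)).
have qm A : measurable A -> quadratic_form (fun c => fine (m c A)).
  move=> mA; apply: (quadratic_form_measure _ mA) => y.
  apply: (quadratic_form_lim (F := y^'+)
    (E := fun z c => L c \1_(`]-oo, z]%classic))).
    by move=> z; apply: (limit_functional_quadratic Slim UU Uoo); exact: poly_bounded_indic.
  by move=> c; case: (mE c) => + _; exact.
pose mu i j : complex_measure T R :=
  difference_measure (m (direction 1 i j)) (m (direction (-1) i j))
    (m (direction 'i i j)) (m (direction (- 'i) i j)).
exists mu; split=> [A mA c|k i j].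
  rewrite [leRHS](_ : _ = (fine (m c A))%:C) ?lecR ?fine_ge0 ?measure_ge0 //.
  by rewrite (qm A mA).
have int c : (m c).-integrable setT (EFin \o (fun y : T => y ^+ k : R)).
  by case: (mE c) => _ /(_ k)[].
have RintE c : Rintegral (m c) setT (fun y : T => y ^+ k) = L c (fun y => y ^+ k).
  by case: (mE c) => _ /(_ k)[].
have [inti intE] := difference_measure_integral (int (direction 1 i j))
  (int (direction (-1) i j)) (int (direction 'i i j)) (int (direction (- 'i) i j)).
split=> //; rewrite [LHS]intE !RintE.
exact: (limit_functional_polar Slim UU Uoo).
Unshelve. all: by end_near. Qed.

End MatrixHamburger.

(** * Third differences on antidiagonals *)

Section ThirdDifference.
Context {R : realType}.
Local Notation C := R[i].
Implicit Types s : nat -> nat -> C.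

(** On an antidiagonal m + n = N the relation reads
    s(m, n) = A + m B + n C + m n D with A, B, C, D depending only on N, which is
    a polynomial of degree at most 2 in m. *)
Lemma related_third_difference s t : translation_invariant t ->
  form_related s t -> third_difference_zero s.
Proof.
move=> t_inv st m n.
have tE p q a b : t p q a b = t (p + q)%N 0%N a b by rewrite t_inv.
have predE (f : nat -> C) (p : nat) : p%:R * f p.-1 = p%:R * f (p - 1)%N.
  by rewrite subn1.
pose N := (m + n)%N.
have sE p q : (p + q)%N = (N + 3)%N -> s p q =
    t (N + 3)%N 0%N (e0 R) (e0 R) + p%:R * t (N + 2)%N 0%N (e1 R) (e0 R)
    + q%:R * t (N + 2)%N 0%N (e0 R) (e1 R) + p%:R * q%:R * t (N + 1)%N 0%N (e1 R) (e1 R).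
  move=> pq; rewrite st (tE p q) (tE p.-1 q) (tE p q.-1) (tE p.-1 q.-1) pq.
  case: p q pq => [|p] [|q] pq /=; rewrite ?mul0r ?mulr0 ?mul0r.
  - by move: pq; rewrite addn3.
  - have -> : q = (N + 2)%N by lia.
    by [].
  - have -> : (p + 0)%N = (N + 2)%N by lia.
    by [].
  - have -> : (p + q.+1)%N = (N + 2)%N by lia.
    have -> : (p.+1 + q)%N = (N + 2)%N by lia.
    by have -> : (p + q)%N = (N + 1)%N by lia.
rewrite !sE /N; try lia.
rewrite !natrD; ring.
Qed.

(** Third differences vanish, so 2 f(m) = m (m - 1) f(2), and the value at N
    forces f(2) = 0. *)
Lemma third_difference_determined (N : nat) (f : nat -> C) :
  (forall m, (m + 3 <= N)%N -> f (m + 3)%N - 3 * f (m + 2)%N + 3 * f (m + 1)%N - f m = 0) ->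
  f 0%N = 0 -> ((0 < N)%N -> f 1%N = 0) -> f N = 0 -> forall m, (m <= N)%N -> f m = 0.
Proof.
move=> f3 f0 f1 fN.
have quad m : (m <= N)%N -> 2 * f m = m%:R * (m%:R - 1) * f 2%N.
  elim/ltn_ind: m => -[|[|[|m]]] IH mN.
  - by rewrite f0 mulr0 !mul0r.
  - by rewrite f1 // subrr !mulr0 mul0r.
  - ring.
  - have := f3 m; rewrite addn3 addn2 addn1 => /(_ mN) E.
    have -> : f m.+3 = 3 * f m.+2 - 3 * f m.+1 + f m.
      by apply/eqP; rewrite -subr_eq0 -E; apply/eqP; ring.
    have := IH m.+2 _ _; have := IH m.+1 _ _; have := IH m _ _.
    move=> /(_ ltac:(lia) ltac:(lia)) E0 /(_ ltac:(lia) ltac:(lia)) E1.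
    move=> /(_ ltac:(lia) ltac:(lia)) E2.
    transitivity (3 * (2 * f m.+2) - 3 * (2 * f m.+1) + 2 * f m); first by ring.
    by rewrite E0 E1 E2 -!natr1; ring.
have two0 : (2 : C) != 0 by rewrite pnatr_eq0.
have [N2|N2] := ltnP N 2.
  by case: N N2 {f3 quad} f1 fN => [|[|//]] _ f1 fN [|[|]] // _; exact: f1.
have f2 : f 2%N = 0.
  have := quad N (leqnn N); rewrite fN mulr0 => /esym/eqP.
  rewrite !mulf_eq0 subr_eq0 pnatr_eq0 -[1]/(1%:R) eqr_nat.
  by case/orP => [/orP[] /eqP N01|/eqP //]; move: N2; rewrite N01.
move=> m mN; have /eqP := quad m mN.
by rewrite f2 mulr0 mulf_eq0 (negbTE two0) => /eqP.
Qed.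

Lemma third_difference_form s : third_difference_zero s ->
  exists t, [/\ is_form t, translation_invariant t & form_related s t].
Proof.
move=> s3.
pose A N := s 0%N N.
(* With the form vanishing at (e0, e1), the three remaining coefficients are
   read off at m = 0, m = N and m = 1 on the antidiagonal of level N. *)
pose B N := (s N.+1 0%N - s 0%N N.+1) / N.+1%:R.
pose D N := (s 1%N N.+1 - A N.+2 - B N.+1) / N.+1%:R.
pose t m n (a b : 'rV[C]_2) := a 0 0 * (b 0 0)^* * A (m + n)%N
  + a 0 1 * (b 0 0)^* * B (m + n)%N + a 0 1 * (b 0 1)^* * D (m + n)%N.
exists t; split.
- move=> m n; split=> [b|a] c u w; rewrite /t !mxE /=.
    by ring.
  by rewrite !rmorphD !rmorphM /=; ring.
- by move=> m n k a b; rewrite /t addnAC addnA.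
have tE m n : t m n (e0 R) (e0 R) + m%:R * t m.-1 n (e1 R) (e0 R)
    + n%:R * t m n.-1 (e0 R) (e1 R) + m%:R * n%:R * t m.-1 n.-1 (e1 R) (e1 R)
    = A (m + n)%N + m%:R * B (m + n).-1 + m%:R * n%:R * D (m + n).-2.
  rewrite /t /e0 /e1 !mxE /= !conjC0 !conjC1.
  case: m n => [|m] [|n] /=; rewrite ?addSn ?addnS ?addn0 ?add0n /=; ring.
move=> m n; rewrite tE; set N := (m + n)%N.
have nE : n = (N - m)%N by rewrite /N addKn.
have mN : (m <= N)%N by rewrite leq_addr.
clearbody N; subst n.
pose f k := s k (N - k)%N
  - (A N + k%:R * B N.-1 + k%:R * (N%:R - k%:R) * D N.-2).
suff fm0 : f m = 0 by have := subr0_eq fm0; rewrite natrB.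
apply: (third_difference_determined (N := N)) => //.
- move=> k kN; have := s3 k (N - (k + 3))%N.
  have -> : (N - (k + 3) + 1 = N - (k + 2))%N by lia.
  have -> : (N - (k + 3) + 2 = N - (k + 1))%N by lia.
  have -> : (N - (k + 3) + 3 = N - k)%N by lia.
  rewrite /f => E; rewrite -[RHS]E !natrD; ring.
- by rewrite /f subn0 !mul0r !addr0 subrr.
- rewrite /f mul1r; clear f; case: N mN => [|[|N]] _ //= _.
  + by rewrite /A /B /= divr1 subnn; ring.
  + rewrite subn1 /D /=.
    have N0 : (N.+1%:R : C) != 0 by rewrite pnatr_eq0.
    have -> : (N.+2%:R : C) - 1 = N.+1%:R by rewrite -natr1 addrK.
    by field.
- rewrite /f subnn subrr mulr0 mul0r addr0; clear f; case: N mN => [|N] _ /=.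
    by rewrite mul0r addr0 subrr.
  have N0 : (N.+1%:R : C) != 0 by rewrite pnatr_eq0.
  by rewrite /A /B; field.
Qed.

End ThirdDifference.

(** * Sobolev moments *)

Section SobolevMoments.
Context {R : realType}.
Local Notation C := R[i].
Local Notation T := (measurableTypeR R).
Implicit Types (mu : 'I_2 -> 'I_2 -> complex_measure T R).

Lemma cintegralZ (nu : complex_measure T R) (a : R) (f : R -> R) :
  cintegrable nu f -> cintegrable nu (fun x : R => a * f x) /\
  cintegral nu (fun x : R => a * f x) = a%:C * cintegral nu f.
Proof.
move=> [Ref Imf].
have [Rei ReE] := charge_integralZ a Ref.
have [Imi ImE] := charge_integralZ a Imf.
split; first by split.
rewrite /cintegral ReE ImE.
by apply/eqP; rewrite eq_complex /=; apply/andP; split; apply/eqP; ring.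
Qed.

Lemma sobolev_integrandE m n (i j : 'I_2) : sobolev_integrand m n i j =
  (fun x : R => (m ^_ i * n ^_ j)%:R * x ^+ (m - i + (n - j))).
Proof.
have derE p (l : 'I_2) (x : R) :
    derive1n l (fun y : R => y ^+ p) x = (p ^_ l)%:R * x ^+ (p - l).
  case: l => -[|[|//]] ?; rewrite /derive1n /=.
    by rewrite ffactn0 subn0 mul1r.
  by rewrite exp_derive1 ffactn1 subn1.
apply/funext => x; rewrite /sobolev_integrand !derE natrM exprD; ring.
Qed.

Lemma sobolev_integral mu (M : nat -> 'I_2 -> 'I_2 -> C) m n :
  (forall k i j, cintegrable (mu i j) (fun x : R => x ^+ k) /\
     cintegral (mu i j) (fun x : R => x ^+ k) = M k i j) ->
  (forall i j, cintegrable (mu i j) (sobolev_integrand m n i j)) /\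
  \sum_(i < 2) \sum_(j < 2) cintegral (mu i j) (sobolev_integrand m n i j)
  = M (m + n)%N 0 0 + m%:R * M (m.-1 + n)%N 1 0 + n%:R * M (m + n.-1)%N 0 1
    + m%:R * n%:R * M (m.-1 + n.-1)%N 1 1.
Proof.
move=> muM.
have H i j : cintegrable (mu i j) (sobolev_integrand m n i j) /\
    cintegral (mu i j) (sobolev_integrand m n i j)
    = (m ^_ i * n ^_ j)%:R * M (m - i + (n - j))%N i j.
  have [int intE] := muM (m - i + (n - j))%N i j.
  have [int' intE'] := cintegralZ (m ^_ i * n ^_ j)%:R int.
  by rewrite sobolev_integrandE; split=> //; rewrite intE' intE rmorph_nat.
split=> [i j|]; first by case: (H i j).
have HE i j : cintegral (mu i j) (sobolev_integrand m n i j)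
    = (m ^_ i * n ^_ j)%:R * M (m - i + (n - j))%N i j by case: (H i j).
under eq_bigr do under eq_bigr do rewrite HE.
have lift01 : lift ord0 ord0 = 1 :> 'I_2 by apply: val_inj.
rewrite !big_ord_recl !big_ord0 /= !addr0 !lift01.
rewrite !ffactn0 /bump /= !addn0 !ffactn1 !subn0 !subn1 !mul1n !muln1 natrM mul1r.
rewrite -[ord0]/(0 : 'I_2); ring.
Qed.

Lemma delta_form_moment mu k m (i j : 'I_2) :
  moment_form mu k m (delta_mx 0 i) (delta_mx 0 j)
  = cintegral (mu i j) (fun x : R => x ^+ (k + m)).
Proof.
rewrite /moment_form (bigD1 i) //= [X in _ + X]big1 => [|l li]; last first.
  by apply: big1 => l' _; rewrite !mxE (negbTE li) andbF !mul0r.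
rewrite (bigD1 j) //= [X in _ + X + _]big1 => [|l lj]; last first.
  by rewrite !mxE (negbTE lj) andbF conjC0 mulr0 mul0r.
by rewrite !mxE !eqxx /= conjC1 !mul1r !addr0.
Qed.

Lemma moment_form_is_form mu : is_form (moment_form mu).
Proof.
move=> m n; split=> [b|a] c u w.
  rewrite /moment_form mulr_sumr -big_split /=; apply: eq_bigr => i _.
  rewrite mulr_sumr -big_split /=; apply: eq_bigr => j _.
  by rewrite !mxE; ring.
rewrite /moment_form /= mulr_sumr -big_split /=; apply: eq_bigr => i _.
rewrite mulr_sumr -big_split /=; apply: eq_bigr => j _.
by rewrite !mxE rmorphD rmorphM /=; ring.
Qed.

Lemma moment_form_invariant mu : translation_invariant (moment_form mu).
Proof. by move=> m n k a b; rewrite /moment_form addnAC addnA. Qed.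

Lemma cintegral_riemann_cvg (nu : complex_measure T R) k :
  (forall k, cintegrable nu (fun x : R => x ^+ k)) ->
  ccvg \oo (fun N => \sum_(c < 2 * N.+1 ^ 2) (grid N c ^+ k)%:C *
                       nu `]grid N c, grid N c.+1]%classic)
    (cintegral nu (fun x : R => x ^+ k)).
Proof.
move=> int; have Rec := charge_riemann_cvg (fun l => (int l).1).
have Imc := charge_riemann_cvg (fun l => (int l).2).
split.
  rewrite (_ : (fun N => _) = (fun N => \sum_(c < 2 * N.+1 ^ 2) grid N c ^+ k *
    fine (Re_measure nu `]grid N c, grid N c.+1]%classic))); first exact: Rec.
  apply/funext => N; rewrite Re_sum; apply: eq_bigr => c _.
  by rewrite Re_mulc /= mul0r subr0.
rewrite (_ : (fun N => _) = (fun N => \sum_(c < 2 * N.+1 ^ 2) grid N c ^+ k *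
  fine (Im_measure nu `]grid N c, grid N c.+1]%classic))); first exact: Imc.
apply/funext => N; rewrite Im_sum; apply: eq_bigr => c _.
by rewrite Im_mulc /= mul0r addr0.
Qed.

(** Riemann sums: on a cell with grid point x the double sum over the sequence
    collapses to the sum of z_i conj(z_j) mu_ij(cell), with z the value at x of
    the vector polynomial with terms a_k x^(m_k); it is nonnegative by positivity of the
    matrix mu(cell). *)
Lemma moment_form_posdef mu : matrix_measure_posdef mu ->
  (forall i j k, cintegrable (mu i j) (fun x : R => x ^+ k)) ->
  form_posdef (moment_form mu).
Proof.
move=> mu_psd int n m a.
pose cell N c := `]grid N c, grid N c.+1]%classic : set T.
pose z N c i : C := \sum_(k < n) a k 0 i * (grid N c ^+ m k)%:C.
apply: (ccvg_ge0 (F := \oo) (f := fun N => \sum_(k < n) \sum_(l < n)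
  \sum_(i < 2) \sum_(j < 2) a k 0 i * (a l 0 j)^* *
    \sum_(c < 2 * N.+1 ^ 2) (grid N c ^+ (m k + m l))%:C * mu i j (cell N c))).
  move=> N.
  suff -> : \sum_(k < n) \sum_(l < n) \sum_(i < 2) \sum_(j < 2)
      a k 0 i * (a l 0 j)^* *
      (\sum_(c < 2 * N.+1 ^ 2) (grid N c ^+ (m k + m l))%:C * mu i j (cell N c))
    = \sum_(c < 2 * N.+1 ^ 2) \sum_(i < 2) \sum_(j < 2)
        z N c i * (z N c j)^* * mu i j (cell N c).
    apply: sumr_ge0 => c _; apply: mu_psd; exact: measurable_itv.
  transitivity (\sum_(k < n) \sum_(l < n) \sum_(c < 2 * N.+1 ^ 2)
    \sum_(i < 2) \sum_(j < 2) a k 0 i * (a l 0 j)^* *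
      ((grid N c ^+ (m k + m l))%:C * mu i j (cell N c))).
    apply: eq_bigr => k _; apply: eq_bigr => l _.
    rewrite [RHS]exchange_big /=; apply: eq_bigr => i _.
    rewrite [RHS]exchange_big /=; apply: eq_bigr => j _.
    by rewrite mulr_sumr.
  under eq_bigr do rewrite exchange_big /=.
  rewrite exchange_big /=; apply: eq_bigr => c _.
  under eq_bigr do rewrite exchange_big /=.
  rewrite exchange_big /=; apply: eq_bigr => i _.
  under eq_bigr do rewrite exchange_big /=.
  rewrite exchange_big /=; apply: eq_bigr => j _.
  rewrite /z mulr_suml mulr_suml; apply: eq_bigr => k _.
  rewrite rmorph_sum mulr_sumr mulr_suml; apply: eq_bigr => l _ /=.
  have conjE w (y : R) : Num.conj (w * y%:C) = Num.conj w * y%:C.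
    by rewrite rmorphM; congr (_ * _); exact: conjc_real.
  rewrite conjE exprD rmorphM /=; ring.
apply: ccvg_sum => k; apply: ccvg_sum => l; apply: ccvg_sum => i.
apply: ccvg_sum => j; apply: ccvgZ.
exact: cintegral_riemann_cvg.
Qed.

(** The integrand with exponents k + i and j is a nonzero multiple of x^k. *)
Lemma sobolev_integrable_expr mu (i j : 'I_2) k :
  (forall m n, cintegrable (mu i j) (sobolev_integrand m n i j)) ->
  cintegrable (mu i j) (fun x : R => x ^+ k).
Proof.
move=> /(_ (k + i)%N j); rewrite sobolev_integrandE addnK subnn addn0 => int.
have [+ _] := cintegralZ ((k + i) ^_ i * j ^_ j)%:R^-1 int.
congr cintegrable; apply/funext => x; rewrite mulrA mulVf ?mul1r //.
by rewrite pnatr_eq0 -lt0n muln_gt0 !ffact_gt0 leq_addl leqnn.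
Qed.

End SobolevMoments.

Theorem mainTheorem1 (R : realType) :
  (forall s : nat -> nat -> R[i],
     third_difference_zero s ->
     (exists t : nat -> nat -> 'rV[R[i]]_2 -> 'rV[R[i]]_2 -> R[i],
        [/\ is_form t, translation_invariant t & form_related s t]) /\
     (forall t : nat -> nat -> 'rV[R[i]]_2 -> 'rV[R[i]]_2 -> R[i],
        is_form t -> translation_invariant t -> form_related s t ->
        form_posdef t -> sobolev_moment_bisequence s)) /\
  (forall (s : nat -> nat -> R[i])
     (mu : 'I_2 -> 'I_2 -> complex_measure (measurableTypeR R) R),
     representing_matrix mu s ->
     third_difference_zero s /\
     (forall (i j : 'I_2) (k : nat),
        cintegrable (mu i j) (fun x : R => x ^+ k)) /\
     [/\ is_form (moment_form mu), form_related s (moment_form mu),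
         translation_invariant (moment_form mu) &
         form_posdef (moment_form mu)]).
Proof.
split=> [s s3|s mu [mu_psd mu_int sE]].
  split=> [|t t_form t_inv st t_psd]; first exact: third_difference_form.
  have [mu [mu_psd muE]] := form_representing_matrix t_form t_inv t_psd.
  exists mu; split=> // m n.
    by move=> i j; case: (sobolev_integral m n muE).
  have [_ ->] := sobolev_integral m n muE.
  by rewrite st !(form_translate t_inv m) !(form_translate t_inv m.-1).
have int i j k : cintegrable (mu i j) (fun x : R => x ^+ k).
  by apply: sobolev_integrable_expr => m n; exact: mu_int.
have related : form_related s (moment_form mu).
  move=> m n; rewrite sE.
  have [_ ->] := sobolev_integral (mu := mu) m n
    (fun k i j => conj (int i j k) erefl).
  by rewrite /e0 /e1 !delta_form_moment.
split; first exact: related_third_difference (moment_form_invariant mu) related.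
split=> //; split=> //.
- exact: moment_form_is_form.
- exact: moment_form_invariant.
- exact: moment_form_posdef.
Qed.
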